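(* Suppose that there is $0<\alpha<1$ such that for $m$-almost every $\underline{x}\in\Sigma_A^+$ one has $d(G(\underline{x},y_1),G(\underline{x},y_2))\le \alpha\, d(y_1,y_2)$ for all $y_1,y_2\in K$. Let $$\mathcal{V}=\Big\{\mu\in S^\infty:\ \tfrac{d(\pi_1^*\mu)}{dm}\in\ker(\Pi_\sigma)\Big\}.$$ Then there exist $D_2\in\mathbb{R}$ and $0<\beta_1<1$ such that for every signed measure $\mu\in\mathcal{V}$ and all $n\ge1$, $$\|F^{*n}\mu\|_\infty\le D_2\,\beta_1^n\,\|\mu\|_{S^\infty}.$$
   Context: Base. Let $A$ be an aperiodic $N\times N$ matrix with entries in $\{0,1\}$ (some power of $A$ has all entries positive), $\Sigma_A^+=\{\underline{x}=(x_i)_{i\ge 0}: x_i\in\{1,\dots,N\},\ A_{x_ix_{i+1}}=1\ \forall i\}$, with the metric $d_\theta(\underline{x},\underline{y})=\sum_{i\ge0}\theta^i(1-\delta(x_i,y_i))$, where $\theta\in(0,1)$ is fixed and $\delta(a,b)=1$ if $a=b$, $0$ otherwise. Let $\sigma$ be the left shift and $m$ a Markov measure associated to $(\Sigma_A^+,\sigma)$ (the $\sigma$-invariant probability given by a stochastic matrix $(p_{ij})$ with $p_{ij}>0$ iff $A_{ij}=1$ and its stationary probability vector). For $\varphi:\Sigma_A^+\to\mathbb{R}$ let $|\varphi|_\theta$ be its Lipschitz constant with respect to $d_\theta$, $\mathcal{F}_\theta(\Sigma_A^+)=\{\varphi:|\varphi|_\theta<\infty\}$, $\|\varphi\|_\theta=\|\varphi\|_\infty+|\varphi|_\theta$.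 The Perron–Frobenius operator $P_\sigma$ of $\sigma$ with respect to $m$ has a spectral gap on $\mathcal{F}_\theta(\Sigma_A^+)$: $P_\sigma=\Pi_\sigma+\mathcal{N}_\sigma$ with $\mathcal{N}_\sigma$ of spectral radius $<1$ and $\Pi_\sigma$ the projection $\Pi_\sigma(\varphi)=\int\varphi\,dm$ (as a constant function). Skew product. $(K,d)$ is a compact metric space with $\operatorname{diam}(K)=1$; $\Sigma:=\Sigma_A^+\times K$; $G:\Sigma\to K$ is measurable (Borel) and $F(\underline{x},y)=(\sigma(\underline{x}),G(\underline{x},y))$. Put $\gamma_{\underline{x}}=\{\underline{x}\}\times K$, $\pi_1(\underline{x},y)=\underline{x}$, $\pi_2(\underline{x},y)=y$; $\pi_1^*$ denotes push-forward, $F^*\mu(E)=\mu(F^{-1}(E))$ for signed measures $\mu$ on $\Sigma$, and $F^{*n}$ is its $n$-th iterate. Spaces of measures. For a finite signed Borel measure $\nu$ on a compact metric space $X$, $\|\nu\|_W=\sup\{|\int g\,d\nu| : g:X\to\mathbb{R}\text{ Lipschitz with constant}\le1,\ \|g\|_\infty\le1\}$. Let $\mathcal{AB}$ be the set of finite signed Borel measures $\mu$ on $\Sigma$, with Jordan decomposition $\mu=\mu^+-\mu^-$, such that $\pi_1^*\mu^+\ll m$ and $\pi_1^*\mu^-\ll m$; write $\phi_1=\frac{d(\pi_1^*\mu)}{dm}$. For positive $\mu\in\mathcal{AB}$ let $\{\mu_{\gamma_{\underline{x}}}\}$ be its Rokhlin disintegration along the leaves: probabilities on $\Sigma$ with $\mu_{\gamma_{\underline{x}}}(\gamma_{\underline{x}})=1$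 for $\phi_1m$-a.e. $\underline{x}$, $\underline{x}\mapsto\mu_{\gamma_{\underline{x}}}(E)$ measurable, and $\mu(E)=\int\mu_{\gamma_{\underline{x}}}(E)\phi_1(\underline{x})\,dm(\underline{x})$ for all measurable $E\subset\Sigma$. The restriction of positive $\mu$ to $\gamma_{\underline{x}}$ is the positive measure on $K$ given by $\mu|_{\gamma_{\underline{x}}}(B)=\phi_1(\underline{x})\,\mu_{\gamma_{\underline{x}}}(\pi_2^{-1}(B))$ (zero where $\phi_1(\underline{x})=0$); for signed $\mu\in\mathcal{AB}$, $\mu|_{\gamma_{\underline{x}}}:=\mu^+|_{\gamma_{\underline{x}}}-\mu^-|_{\gamma_{\underline{x}}}$. Set $\|\mu\|_\infty=\operatorname{ess\,sup}_{\underline{x}}\|\mu|_{\gamma_{\underline{x}}}\|_W$ (with respect to $m$), $\mathcal{L}^\infty=\{\mu\in\mathcal{AB}:\|\mu\|_\infty<\infty\}$, $S^\infty=\{\mu\in\mathcal{L}^\infty:\phi_1\in\mathcal{F}_\theta(\Sigma_A^+)\}$ and $\|\mu\|_{S^\infty}=\|\phi_1\|_\theta+\|\mu\|_\infty$. *)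

(* Defs.v *)
From HB Require Import structures.
From mathcomp Require Import all_boot all_order all_algebra.
From mathcomp Require Import all_classical all_reals all_analysis.
From mathcomp Require Import measurable_realfun ess_sup_inf.

Set Implicit Arguments.
Unset Strict Implicit.
Unset Printing Implicit Defensive.

Import Order.TTheory GRing.Theory Num.Theory.
Import numFieldNormedType.Exports.

Local Open Scope classical_set_scope.
Local Open Scope ring_scope.
Local Open Scope charge_scope.

(* Metric spaces carrying their Borel sigma-algebra.  Measurable types are
   pointed in the library, so these spaces are nonempty. *)
HB.mixin Record isBorel d (R : numDomainType) T
    & Measurable d T & Metric R T := {
  measurable_borelE : @measurable d T = <<s @open T >>
}.

#[short(type="borelMetricType")]
HB.structure Definition BorelMetric d (R : numDomainType) :=
  {T of Measurable d T & Metric R T & isBorel d R T}.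

Definition diam (R : realType) (T : metricType R) : \bar R :=
  ereal_sup [set (mdist x y)%:E | x in [set: T] & y in [set: T]].

(* At x = y the quotient is 0 / 0 = 0, which does not affect the supremum of
   the difference quotients and makes the constant 0 on a one-point space. *)
Definition lip_const (R : realType) (T : metricType R) (f : T -> R) : \bar R :=
  ereal_sup [set (`|f x - f y| / mdist x y)%:E | x in [set: T] & y in [set: T]].

Definition sup_norm (R : realType) (T : Type) (f : T -> R) : \bar R :=
  ereal_sup [set `|f x|%:E | x in [set: T]].

Definition lip_norm (R : realType) (T : metricType R) (f : T -> R) : \bar R :=
  (sup_norm f + lip_const f)%E.

Definition Lip (R : realType) (T : metricType R) : set (T -> R) :=
  [set f | (lip_const f < +oo)%E].

Definition transition_matrix N (A : 'M[nat]_N) :=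
  (forall i j, A i j \in [:: 0; 1]%N) /\
  (exists2 k, (0 < k)%N & forall i j, (0 < (A ^+ k) i j)%N).

(* The hypotheses on A and theta are parameters of the type: the former make it
   nonempty, the latter make d_theta a metric. *)
Record subshift (R : realType) (N : nat) (A : 'M[nat]_N.+1) (theta : R)
    (Aok : transition_matrix A) (theta01 : 0 < theta < 1) := Subshift {
  coord :> nat -> 'I_N.+1 ;
  coordP : forall i, A (coord i) (coord i.+1) = 1%N
}.

Section subshift_metric.
Context (R : realType) (N : nat) (A : 'M[nat]_N.+1) (theta : R).
Context (Aok : transition_matrix A) (theta01 : 0 < theta < 1).
Local Notation X := (subshift Aok theta01).
Implicit Types x y z : X.

Lemma subshift_ext x y : (forall i, x i = y i) -> x = y.
Proof.
case: x y => [x xP] [y yP] /= xy.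
have {}xy : x = y by apply/funext.
by subst y; congr Subshift; exact: Prop_irrelevance.
Qed.

Lemma subshift_nonempty : exists x : X, True.
Proof.
case: Aok => A01 [k k0 Ak].
have next i : exists j, A i j = 1%N.
  case: k k0 Ak => // k _ Ak; have := Ak i i.
  rewrite exprS -mulmxE mxE => h; apply: contrapT => none.
  move: h; rewrite big1// => j _.
  have := A01 i j; rewrite !inE => /orP[/eqP ->|/eqP e]; first by rewrite mul0r.
  by exfalso; apply: none; exists j.
have [f fP] := choice next.
by unshelve eexists; [exists (fun n => iter n f ord0) => i; exact: fP|].
Qed.

HB.instance Definition _ := gen_eqMixin X.
HB.instance Definition _ := gen_choiceMixin X.
HB.instance Definition _ := isPointed.Build X (sval (cid subshift_nonempty)).

Definition dtheta_term x y (i : nat) : R :=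
  theta ^+ i * (1 - (x i == y i)%:R).

Definition dtheta x y : R := limn (series (dtheta_term x y)).

Lemma dtheta_term_ge0 x y i : 0 <= dtheta_term x y i.
Proof.
case/andP: theta01 => t0 _; rewrite mulr_ge0 ?exprn_ge0 ?(ltW t0)//.
by case: (_ == _); rewrite ?subrr ?subr0.
Qed.

Lemma is_cvg_dtheta x y : cvgn (series (dtheta_term x y)).
Proof.
case/andP: theta01 => t0 t1.
apply: (@series_le_cvg _ _ (geometric 1 theta)) => [i|i|i|].
- exact: dtheta_term_ge0.
- by rewrite /= mul1r exprn_ge0 ?(ltW t0).
- rewrite /= mul1r /dtheta_term; case: (_ == _).
    by rewrite subrr mulr0 exprn_ge0 ?(ltW t0).
  by rewrite subr0 mulr1.
- by apply: is_cvg_geometric_series; rewrite ger0_norm// ltW.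
Qed.

Lemma dtheta_term_le x y i : dtheta_term x y i <= dtheta x y.
Proof.
have nd : nondecreasing_seq (series (dtheta_term x y)).
  by apply: nondecreasing_series => n _ _; exact: dtheta_term_ge0.
apply: le_trans (nondecreasing_cvgn_le nd (@is_cvg_dtheta x y) i.+1).
rewrite /series /= big_nat_recr//= lerDr.
by apply: sumr_ge0 => j _; exact: dtheta_term_ge0.
Qed.

Lemma dthetaxx x : dtheta x x = 0.
Proof.
rewrite /dtheta (_ : series _ = fun=> 0) ?lim_cst//.
apply/funext => n; rewrite /series /= big1// => i _.
by rewrite /dtheta_term eqxx subrr mulr0.
Qed.

Lemma dtheta_eq0 x y : dtheta x y = 0 -> x = y.
Proof.
case/andP: theta01 => t0 _ d0; apply: subshift_ext => i; apply/eqP.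
have := dtheta_term_le x y i; rewrite d0 /dtheta_term.
by case: eqP => //= _; rewrite subr0 mulr1 leNgt exprn_gt0.
Qed.

Lemma dtheta_sym x y : dtheta x y = dtheta y x.
Proof.
rewrite /dtheta (_ : dtheta_term x y = dtheta_term y x)//.
by apply/funext => i; rewrite /dtheta_term eq_sym.
Qed.

Lemma dtheta_triangle y x z : dtheta x z <= dtheta x y + dtheta y z.
Proof.
case/andP: theta01 => t0 _.
rewrite /dtheta -lim_seriesD; try exact: is_cvg_dtheta.
apply: lim_series_le; [exact: is_cvg_dtheta| |].
  by apply: is_cvg_seriesD; exact: is_cvg_dtheta.
move=> i; rewrite fctE /dtheta_term -mulrDr ler_wpM2l ?exprn_ge0 ?(ltW t0)//.
case: (eqVneq (x i) (y i)) => [->|xy] /=; first by rewrite subrr add0r.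
case: (eqVneq (y i) (z i)) => [<-|yz] /=.
  by rewrite subrr addr0 subr0 lerBlDr lerDl.
by rewrite !subr0 (@le_trans _ _ 1)// ?lerDl// lerBlDr lerDl.
Qed.

HB.instance Definition _ :=
  isMetric.Build R X dthetaxx dtheta_eq0 dtheta_sym dtheta_triangle.

HB.instance Definition _ :=
  Measurable.copy X (g_sigma_algebraType (@open X)).

HB.instance Definition _ :=
  isBorel.Build (sigma_display (@open X)) R X erefl.

Definition left_shift x : X := Subshift Aok theta01 (fun i => coordP x i.+1).

Lemma dtheta_shift x y : dtheta (left_shift x) (left_shift y) <= theta^-1 * dtheta x y.
Proof.
case/andP: theta01 => t0 _.
have h n : series (dtheta_term (left_shift x) (left_shift y)) n
    <= theta^-1 * series (dtheta_term x y) n.+1.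
  rewrite /series /= big_nat_recl//= mulrDr mulr_sumr.
  rewrite (eq_bigr (fun i => theta^-1 * dtheta_term x y i.+1)); last first.
    by move=> i _; rewrite /dtheta_term exprS -mulrA mulKf ?(gt_eqF t0).
  by rewrite lerDr mulr_ge0 ?invr_ge0 ?(ltW t0)// dtheta_term_ge0.
apply: limr_le; first exact: is_cvg_dtheta.
apply: nearW => n; apply: le_trans (h n) _.
rewrite ler_wpM2l ?invr_ge0 ?(ltW t0)//.
apply: nondecreasing_cvgn_le; last exact: is_cvg_dtheta.
by apply: nondecreasing_series => i _ _; exact: dtheta_term_ge0.
Qed.

Lemma measurable_shift : measurable_fun [set: X] left_shift.
Proof.
case/andP: theta01 => t0 _.
apply: (@measurability _ _ _ _ _ _ (@open X)) => // _ [U oU <-].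
rewrite setTI; suff oV : open (left_shift @^-1` U) by exact: sub_sigma_algebra.
rewrite openE => x /= Ux.
have : nbhs (left_shift x) U by exact: open_nbhs_nbhs.
move=> /nbhs_ballP[e /= e0 eU].
apply/nbhs_ballP; exists (theta * e) => /=; first by rewrite mulr_gt0.
move=> y; rewrite ballEmdist /= => xy; apply: eU; rewrite ballEmdist /=.
by apply: le_lt_trans (dtheta_shift x y) _; rewrite ltr_pdivrMl.
Qed.

Definition cylinder (n : nat) (w : nat -> 'I_N.+1) : set X :=
  [set x | forall k, (k <= n)%N -> x k = w k].

Definition markov_measure (P : 'M[R]_N.+1) (p : 'rV[R]_N.+1)
    (m : probability X R) :=
  [/\ (forall i j, 0 <= P i j) /\ (forall i, \sum_j P i j = 1),
      (forall i j, 0 < P i j <-> A i j = 1%N),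
      (forall i, 0 <= p 0 i) /\ \sum_i p 0 i = 1,
      p *m P = p
    & forall n w, m (cylinder n w) =
        (p 0 (w 0%N) * \prod_(k < n) P (w k) (w k.+1))%:E].

End subshift_metric.

Section charges.
Context d d' (T : measurableType d) (U : measurableType d') (R : realType).
Implicit Type nu : {charge set T -> \bar R}.

Lemma hahn_exists nu :
  exists PN : set T * set T, hahn_decomposition nu PN.1 PN.2.
Proof. by have [P [N PN]] := Hahn_decomposition nu; exists (P, N). Qed.

(* The Jordan parts do not depend on the chosen Hahn decomposition. *)
Definition jpos nu : {finite_measure set T -> \bar R} :=
  jordan_pos (svalP (cid (hahn_exists nu))).

Definition jneg nu : {finite_measure set T -> \bar R} :=
  jordan_neg (svalP (cid (hahn_exists nu))).

Definition push (f : T -> U) (mf : measurable_fun [set: T] f) nu :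
    {charge set U -> \bar R} :=
  measure_function_pushforward__canonical__charge_Charge nu mf.

Definition charge_integral nu (g : T -> R) : \bar R :=
  (\int[jpos nu]_x (g x)%:E - \int[jneg nu]_x (g x)%:E)%E.

End charges.

Definition Wnorm d (R : realType) (K : borelMetricType d R)
    (nu : {charge set K -> \bar R}) : \bar R :=
  ereal_sup [set `|charge_integral nu g|%E | g in
    [set g : K -> R | (forall x y, `|g x - g y| <= mdist x y) /\
                      (forall x, `|g x| <= 1)]].

(* Signed measures live on the product sigma-algebra of X * K, which is the Borel
   sigma-algebra of the product when X and K are separable, e.g. compact. *)
Section spaces_of_measures.
Context (R : realType) dX dK (X : borelMetricType dX R)
  (K : borelMetricType dK R) (m : probability X R).
Implicit Type mu : {charge set (X * K)%type -> \bar R}.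

Definition AB : set (charge (X * K)%type R) :=
  [set mu | pushforward (jpos mu) fst `<< m /\
            pushforward (jneg mu) fst `<< m].

Definition marginal_density mu : X -> \bar R :=
  'd (push measurable_fst mu) '/d m.

(* A density is determined m-almost everywhere only: phi1 mu is a Lipschitz
   version of it whenever there is one.  That version is unique when m charges
   every nonempty open set, as Markov measures do. *)
Definition phi1 mu : X -> R :=
  xget (fine \o marginal_density mu)
    [set phi | Lip phi /\
               ae_eq m [set: X] (EFin \o phi) (marginal_density mu)].

Definition disintegration (mu : {finite_measure set (X * K)%type -> \bar R})
    (k : X -> probability (X * K)%type R) :=
  [/\ forall E, measurable E -> measurable_fun [set: X] (fun x => k x E),
      \forall x \ae pushforward mu fst, k x ([set x] `*` [set: K]) = 1%E
    & forall E, measurable E ->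
        mu E = (\int[m]_x
          (k x E * marginal_density (charge_of_finite_measure mu) x))%E].

Definition leaf_pos (mu : {finite_measure set (X * K)%type -> \bar R})
    (k : X -> probability (X * K)%type R) (x : X) :
    {charge set K -> \bar R} :=
  cscale (fine (marginal_density (charge_of_finite_measure mu) x))
    (push measurable_snd (charge_of_finite_measure (k x))).

Definition leaf mu (kp kn : X -> probability (X * K)%type R) (x : X) :
    {charge set K -> \bar R} :=
  cadd (leaf_pos (jpos mu) kp x) (copp (leaf_pos (jneg mu) kn x)).

(* For compact K the disintegrations of mu in AB exist by Rokhlin's theorem and
   are unique almost everywhere, so all choices of kp and kn give the same
   essential supremum and the infimum is their common value. *)
Definition Linf_norm mu : \bar R :=
  ereal_inf [set ess_sup m (fun x => Wnorm (leaf mu kp kn x)) | kp in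
    disintegration (jpos mu) & kn in disintegration (jneg mu)].

Definition Linf : set (charge (X * K)%type R) :=
  [set mu | AB mu /\ (Linf_norm mu < +oo)%E].

Definition Sinf : set (charge (X * K)%type R) :=
  [set mu | Linf mu /\ Lip (phi1 mu)].

Definition Sinf_norm mu : \bar R := (lip_norm (phi1 mu) + Linf_norm mu)%E.

Definition Pi_sigma (phi : X -> R) : X -> R :=
  fun _ => (\int[m]_x phi x)%R.

Definition Vspace : set (charge (X * K)%type R) :=
  [set mu | Sinf mu /\ Pi_sigma (phi1 mu) = (fun=> 0)].

End spaces_of_measures.

Section skew_product.
Context (R : realType) (N : nat) (A : 'M[nat]_N.+1) (theta : R).
Context (Aok : transition_matrix A) (theta01 : 0 < theta < 1).
Local Notation X := (subshift Aok theta01).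
Context dK (K : borelMetricType dK R) (G : {mfun (X * K)%type >-> K}).

Definition skew (z : X * K) : X * K := (left_shift z.1, G z).

Lemma measurable_skew : measurable_fun [set: (X * K)%type] skew.
Proof.
apply: measurable_fun_pair; last exact: measurable_funPT.
exact: measurableT_comp (@measurable_shift _ _ _ _ Aok theta01) measurable_fst.
Qed.

Definition F_star : {charge set (X * K)%type -> \bar R} ->
    {charge set (X * K)%type -> \bar R} := push measurable_skew.

End skew_product.

(* Main.v *)
Require Import Defs.
From mathcomp Require Import all_boot all_order all_algebra.
From mathcomp Require Import all_classical all_reals all_analysis.
From HB Require Import structures.
From mathcomp Require Import measurable_realfun ess_sup_inf ring lra.
Import Order.TTheory GRing.Theory Num.Theory.
Import numFieldNormedType.Exports.
Local Open Scope classical_set_scope.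
Local Open Scope ring_scope.

Set Implicit Arguments.
Unset Strict Implicit.
Unset Printing Implicit Defensive.

(** The leaf of [F^* mu] over [x] is an average of images of leaves of [mu]: for
    each symbol [i] that may precede [x], the leaf over [i x] is pushed by
    [G (i x, .)], with the weight that the time-reversed Markov chain gives to the
    transition from [x_0] to [i].  Integrating a test function against the image
    of a signed measure [n] on one leaf amounts to integrating against [n] a
    function with Lipschitz constant [alpha], that is, a constant plus [alpha]
    times a test function; so the dual norm of the image is at most [alpha] times
    the dual norm of [n] plus [|n (K)|] ([contracted_test_bound]).  Since [n (K)]
    is the value at the base point of the density [phi] of the marginal,
    averaging gives
      [|F^* mu|_oo <= alpha |mu|_oo + sup |phi|]        ([Linf_norm_F_star]),
    while the density of [F^* mu] is the transfer operator applied to [phi]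
    ([has_density_F_star]).  A geometric decay of [sup |P^n phi|] therefore gives
    a geometric decay of [|F^{*n} mu|_oo], at any rate above both [alpha] and the
    rate of the densities.

    The decay of the densities ([oscillation_decay]) is a Doeblin argument.  The
    weights of the inverse branches depend on the first letter only, so the
    transfer operator multiplies by [theta] the Lipschitz constant of a function
    along points with the same first letter.  Up to an error controlled by that
    constant a function depends on the first letter only, and on such functions
    the operator is the reversed stochastic matrix, a power of which has positive
    entries and thus contracts oscillations.  Finally [F^*] preserves the total
    mass, so all densities have mean zero and are bounded by their oscillation.

    The norm is defined through disintegrations of the Jordan parts, and those of
    [F^* mu] are not the images of the Jordan parts of [mu], but only dominated by
    them.  Their disintegrations are obtained by multiplying the image kernels by
    Radon-Nikodym densities ([leaf_kernel_dominated]).  That the difference of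
    leaves is the expected one for almost every base point is a consequence of
    the uniqueness of disintegrations, which rests on a countable pi-system
    generating the Borel sets of the compact space [K] ([leaf_kernel_unique],
    [jordan_leaf_kernels]). *)

(** * Borel metric spaces *)

Lemma fin_num_subE (R : realDomainType) (a b c d : \bar R) :
  a \is a fin_num -> b \is a fin_num -> c \is a fin_num -> d \is a fin_num ->
  (a - b = c - d <-> a + d = c + b)%E.
Proof.
move: a b c d => [a||] [b||] [c||] [d||]// _ _ _ _; rewrite -!EFinB -!EFinD.
by split => -[e]; congr EFin; lra.
Qed.

Section borel_continuous.
Context (R : realType) d (T : borelMetricType d R).

Lemma borel_openT (U : set T) : open U -> measurable U.
Proof. by move=> oU; rewrite measurable_borelE; exact: sub_sigma_algebra. Qed.

Lemma borel_set1 (x : T) : measurable [set x].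
Proof.
rewrite -(setCK [set x]); apply: measurableC; apply: borel_openT.
exact/closed_openC/accessible_closed_set1/hausdorff_accessible/metric_hausdorff.
Qed.

Lemma borel_continuous_measurable d' (U : borelMetricType d' R) (f : T -> U) :
  continuous f -> measurable_fun [set: T] f.
Proof.
move=> cf; apply: (@measurability _ _ _ _ _ _ (@open U)).
  exact: measurable_borelE.
move=> _ [V oV <-]; rewrite setTI; apply: borel_openT.
by move/continuousP : cf; exact.
Qed.

Lemma borel_continuous_measurableR (f : T -> R) :
  continuous f -> measurable_fun [set: T] f.
Proof.
move=> cf; apply: (measurability _ (RGenOpens.measurableE R)).
move=> _ [_ [a [b ->] <-]]; rewrite setTI; apply: borel_openT.
by move/continuousP : cf; apply; exact: interval_open.
Qed.

Lemma lipschitz_continuous (f : T -> R) (k : R) :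
  (forall x y, `|f x - f y| <= k * mdist x y) -> continuous f.
Proof.
move=> fk x; apply/cvgrPdist_lt => e e0.
have k0 : 0 < `|k| + 1 by rewrite ltr_wpDl.
apply/nbhs_ballP; exists (e / (`|k| + 1)) => /=; first exact: divr_gt0.
move=> y; rewrite ballEmdist /= ltr_pdivlMr// => xy.
apply: le_lt_trans (fk x y) _; apply: le_lt_trans xy.
rewrite mulrC ler_wpM2l ?mdist_ge0// (le_trans (ler_norm _))//.
by rewrite lerDl.
Qed.

End borel_continuous.

(** * Mixtures and densities of measures *)

Section kernel_integral.
Context d d' (X : measurableType d) (Y : measurableType d') (R : realType).
Variables (m : {measure set X -> \bar R}) (l : {measure set Y -> \bar R}).
Variable k : X -> {measure set Y -> \bar R}.
Hypothesis mk : forall E, measurable E -> measurable_fun [set: X] (k ^~ E).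
Hypothesis lE : forall E, measurable E -> l E = (\int[m]_x k x E)%E.

Import HBNNSimple.
Local Open Scope ereal_scope.

Lemma integral_mixture_nnsfun (f : {nnsfun Y >-> R}) :
  \int[l]_y (f y)%:E = \int[m]_x \int[k x]_y (f y)%:E.
Proof.
have mI r : measurable_fun [set: X] (fun x => k x (f @^-1` [set r])).
  exact: mk.
transitivity (\sum_(r \in range f) \int[m]_x (r%:E * k x (f @^-1` [set r]))).
  rewrite integralT_nnsfun sintegralE; apply: eq_fsbigr => r /[!inE] -[y _ <-].
  by rewrite ge0_integralZl// ?lee_fin// -lE.
rewrite -ge0_integral_fsum//.
- apply: eq_integral => x _.
  by rewrite integralT_nnsfun sintegralE.
- by move=> r; apply: measurable_funeM.
- move=> r x _; have := mulemu_ge0 (fun r => f @^-1` [set r]).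
  by apply; exact: preimage_nnfun0.
Qed.

(** Both sides are continuous along the increasing approximation of [f] by simple
    functions, for which the identity is the hypothesis [lE]. *)
Lemma integral_mixture (f : Y -> \bar R) :
  (forall y, 0 <= f y) -> measurable_fun [set: Y] f ->
  \int[l]_y f y = \int[m]_x \int[k x]_y f y.
Proof.
move=> f0 mf; pose f_ := nnsfun_approx measurableT mf.
have mf_ n : measurable_fun [set: Y] (EFin \o f_ n) by exact/measurable_EFinP.
have f_0 n y : 0 <= (EFin \o f_ n) y by rewrite lee_fin.
have ndf_ y : {homo (fun n => (EFin \o f_ n) y) : a b / (a <= b)%N >-> a <= b}.
  by move=> a b ab; rewrite lee_fin; exact/lefP/nd_nnsfun_approx.
have E (mu : {measure set Y -> \bar R}) :
    \int[mu]_y f y = lim (\int[mu]_y (f_ n y)%:E @[n --> \oo]).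
  rewrite -monotone_convergence//=; last 2 first.
  - by move=> n y _; exact: f_0.
  - by move=> y _; exact: ndf_.
  by apply: eq_integral => y _; apply/esym/cvg_lim => //;
    exact: cvg_nnsfun_approx.
rewrite E; under eq_fun do rewrite integral_mixture_nnsfun.
rewrite -monotone_convergence//=.
- by apply: eq_integral => x _; rewrite E.
- by move=> n; exact: (measurable_fun_integral_kernel mk (f_0 n) (mf_ n)).
- by move=> n x _; apply: integral_ge0 => y _; exact: f_0.
- move=> x _ a b ab; apply: ge0_le_integral => //; last by move=> y _; exact: ndf_.
  + by move=> y _; exact: f_0.
  + exact: mf_.
  + exact: mf_.
Qed.

End kernel_integral.

Section density_measure.
Context d (T : measurableType d) (R : realType).
Variables (mu : {measure set T -> \bar R}) (h : T -> \bar R).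
Hypotheses (mh : measurable_fun [set: T] h) (h0 : forall x, (0 <= h x)%E).

(** The two proofs are arguments so that the measure structure can be inferred
    from the term. *)
Definition density_measure of measurable_fun [set: T] h &
  (forall x, (0 <= h x)%E) := fun E : set T => (\int[mu]_(x in E) h x)%E.

Local Notation nu := (density_measure mh h0).

Let density0 : nu set0 = 0%E.
Proof. exact: integral_set0. Qed.

Let density_ge0 E : (0 <= nu E)%E.
Proof. exact: integral_ge0. Qed.

Let density_sigma_additive : semi_sigma_additive nu.
Proof. exact: semi_sigma_additive_nng_induced. Qed.

HB.instance Definition _ := isMeasure.Build _ _ _ nu
  density0 density_ge0 density_sigma_additive.

End density_measure.

Section finite_push.
Context d d' (T : measurableType d) (U : measurableType d') (R : realType).
Variables (f : T -> U) (mf : measurable_fun [set: T] f).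
Variable mu : {finite_measure set T -> \bar R}.

Let pm : {measure set U -> \bar R} :=
  measure_function_pushforward__canonical__measure_function_Measure mu mf.

(** The image of a finite measure, with its finiteness attached: domination and
    Radon-Nikodym derivatives ask for it. *)
Definition finite_push of measurable_fun [set: T] f : set U -> \bar R :=
  pushforward mu f.

HB.instance Definition _ := isMeasure.Build _ _ _ (finite_push mf)
  (measure0 pm) (measure_ge0 pm) (@measure_semi_sigma_additive _ _ _ pm).

Let finite_push_fin : fin_num_fun (finite_push mf).
Proof.
move=> E mE; apply: fin_num_measure.
by rewrite -[X in measurable X]setTI; exact: mf.
Qed.

HB.instance Definition _ := @Measure_isFinite.Build _ _ _
  (finite_push mf) finite_push_fin.

End finite_push.

(** * Countable generation of the Borel sets *)

Section pi_system.
Context (R : realType) d (T : borelMetricType d R).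

(** The finite intersections of a countable basis, enumerated through the coding
    of finite sequences by natural numbers; index [0] is reserved for the whole
    space, which then covers the space with finite measure in uniqueness
    arguments. *)
Lemma second_countable_pi_system : @second_countable T ->
  exists G : nat -> set T, [/\ measurable = <<s range G>>,
    setI_closed (range G) & G 0%N = setT].
Proof.
move=> [B cB [Bopen Bb]].
have [B0|[e]] : B = set0 \/ $|{surjfun [set: nat] >-> B}| by exact/pfcard_geP.
  have [U [+ _] _] := Bb point setT (filterT : nbhs point setT).
  by rewrite B0.
have eB n : B (e n) by exact: (@funS _ _ _ _ e n I).
pose F (s : seq nat) : set T := \big[setI/setT]_(i <- s) e i.
pose G n := F (odflt [::] (unpickle n)).
have FG s : range G (F s) by exists (pickle s) => //; rewrite /G pickleK.
have mG n : measurable (G n).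
  rewrite /G /F; elim: (odflt _ _) => [|i s ih]; first by rewrite big_nil.
  by rewrite big_cons; apply: measurableI => //; exact/borel_openT/Bopen/eB.
exists (fun n => if n is k.+1 then G k else setT); split => //.
- rewrite measurable_borelE; apply/seteqP; split.
    apply: smallest_sub; first exact: smallest_sigma_algebra.
    move=> U oU.
    have -> : U = \bigcup_(n in [set n | e n `<=` U]) e n.
      apply/seteqP; split => [x Ux|x [n /= nU /nU//]].
      have [V [BV Vx] VU] := Bb x U (open_nbhs_nbhs (conj oU Ux)).
      have [n _ nV] := @surj _ _ _ _ e V BV.
      by exists n => /=; rewrite nV.
    set S := [set n | _].
    have H n : measurable ((e n : set (g_sigma_algebraType
        (range (fun n => if n is k.+1 then G k else setT))))).
      apply: sub_sigma_algebra; exists (pickle [:: n]).+1 => //=.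
      by rewrite /G pickleK /= /F big_seq1.
    by apply: (@bigcup_measurable _ (g_sigma_algebraType _)) => n _; exact: H.
  apply: smallest_sub; first exact: smallest_sigma_algebra.
  move=> _ [[|n] _ <-]; first by apply: sub_sigma_algebra; exact: openT.
  by have := mG n; rewrite measurable_borelE.
- move=> _ _ [[|n] _ <-] [[|k] _ <-].
  + by exists 0%N => //; rewrite setTI.
  + by exists k.+1 => //; rewrite setTI.
  + by exists n.+1 => //; rewrite setIT.
  + pose s : seq nat := odflt [::] (unpickle n).
    pose t : seq nat := odflt [::] (unpickle k).
    exists (pickle (s ++ t)).+1 => //.
    by rewrite /G pickleK /= /F big_cat.
Qed.

End pi_system.

(** * Jordan parts of a signed measure *)

Section charge_integral_difference.
Context d (T : measurableType d) (R : realType).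

Lemma bounded_integrable (mu : {measure set T -> \bar R}) (g : T -> R) (c : R) :
  (mu setT < +oo)%E -> measurable_fun [set: T] g -> (forall x, `|g x| <= c) ->
  mu.-integrable [set: T] (EFin \o g).
Proof.
move=> mufin mg gc; apply: measurable_bounded_integrable => //.
by exists c; split => [|r cr x _ /=]; [exact: num_real|exact: le_trans (gc x) (ltW cr)].
Qed.

Lemma jordanE (nu : {charge set T -> \bar R}) (E : set T) : measurable E ->
  nu E = (jpos nu E - jneg nu E)%E.
Proof.
move=> mE; have -> : nu E = (jpos nu E + (-1)%:E * jneg nu E)%E.
  exact: (jordan_decomp (svalP (cid (hahn_exists nu))) mE).
by rewrite EFinN mulN1e.
Qed.

(** The positive part is the trace of [nu] on a Hahn set, where the bound on [nu]
    can be used. *)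
Lemma jpos_le (nu : {charge set T -> \bar R}) (l : {measure set T -> \bar R}) :
  (forall E, measurable E -> nu E <= l E)%E ->
  forall E, measurable E -> (jpos nu E <= l E)%E.
Proof.
move=> nul E mE; have [[mP _] _ _ _] := svalP (cid (hahn_exists nu)).
have -> : jpos nu E = nu (E `&` (sval (cid (hahn_exists nu))).1).
  by rewrite /= cjordan_posE /= /crestr0 mem_set.
apply: le_trans (nul _ (measurableI _ _ mE mP)) _.
by apply: le_measure; rewrite ?inE//; exact: measurableI.
Qed.

Lemma jneg_le (nu : {charge set T -> \bar R}) (l : {measure set T -> \bar R}) :
  (forall E, measurable E -> - nu E <= l E)%E ->
  forall E, measurable E -> (jneg nu E <= l E)%E.
Proof.
move=> nul E mE; have [_ [mN _] _ _] := svalP (cid (hahn_exists nu)).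
have -> : jneg nu E = (- nu (E `&` (sval (cid (hahn_exists nu))).2))%E.
  by rewrite /= cjordan_negE /= /crestr0 mem_set.
apply: le_trans (nul _ (measurableI _ _ mE mN)) _.
by apply: le_measure; rewrite ?inE//; exact: measurableI.
Qed.

(** The decomposition [n1 - n2] need not be minimal: [nu^+ + n2] and [n1 + nu^-]
    are the same measure, and integrals are additive in the measure. *)
Lemma charge_integralB (nu : {charge set T -> \bar R})
    (n1 n2 : {measure set T -> \bar R}) (g : T -> R) (c : R) :
  (n1 setT < +oo)%E -> (n2 setT < +oo)%E ->
  (forall E, measurable E -> nu E = n1 E - n2 E)%E ->
  measurable_fun [set: T] g -> (forall x, `|g x| <= c) ->
  charge_integral nu g = (\int[n1]_x (g x)%:E - \int[n2]_x (g x)%:E)%E.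
Proof.
move=> f1 f2 nuE mg gc; rewrite /charge_integral.
have fin (n : {measure set T -> \bar R}) : (n setT < +oo)%E ->
    forall E, measurable E -> n E \is a fin_num.
  move=> nT E mE; rewrite ge0_fin_numE//; apply: le_lt_trans nT.
  by apply: le_measure; rewrite ?inE.
have jp : (jpos nu setT < +oo)%E by rewrite ltey_eq fin_num_measure.
have jn : (jneg nu setT < +oo)%E by rewrite ltey_eq fin_num_measure.
have ig (n : {measure set T -> \bar R}) : (n setT < +oo)%E ->
    n.-integrable setT (EFin \o g) by move=> ?; exact: (@bounded_integrable _ _ c).
have ifin (n : {measure set T -> \bar R}) : (n setT < +oo)%E ->
    (\int[n]_x (g x)%:E)%E \is a fin_num.
  by move=> nT; apply: integrable_fin_num => //; exact: ig.
apply/fin_num_subE; try exact: ifin.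
rewrite -!integral_measure_add ?ig//.
apply: eq_measure_integral => A mA _.
transitivity (jpos nu A + n2 A)%E; first exact: measure_addE.
transitivity (n1 A + jneg nu A)%E; last exact/esym/measure_addE.
by apply/fin_num_subE; rewrite ?fin// -jordanE// nuE.
Qed.

End charge_integral_difference.

(** * Disintegration along the leaves *)

Section leaf_kernels.
Context (R : realType) dX dK (X : borelMetricType dX R)
  (K : borelMetricType dK R) (m : probability X R).
Local Notation XK := (X * K)%type.
Implicit Types (l : {finite_measure set XK -> \bar R})
  (k : X -> {measure set XK -> \bar R}).
Local Open Scope ereal_scope.

Definition on_leaf (x : X) : set XK := [set x] `*` [set: K].

Lemma measurable_on_leaf x : measurable (on_leaf x).
Proof. by apply: measurableX => //; exact: borel_set1. Qed.

(** A disintegration whose conditional measures absorb the density of the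
    marginal.  Unlike probability kernels, these can be added, pushed forward and
    averaged without renormalization, and vanish where the marginal does. *)
Definition leaf_kernel (l : set XK -> \bar R) k :=
  [/\ forall E, measurable E -> measurable_fun [set: X] (fun x => k x E),
      forall x, k x setT < +oo,
      \forall x \ae m, k x (~` on_leaf x) = 0
    & forall E, measurable E -> l E = \int[m]_x k x E].

Lemma measurable_fst_preimage (B : set X) : measurable B ->
  measurable (fst @^-1` B : set XK).
Proof. by move=> mB; rewrite -[X in measurable X]setTI; exact: measurable_fst. Qed.

Lemma measurable_snd_preimage (B : set K) : measurable B ->
  measurable (snd @^-1` B : set XK).
Proof. by move=> mB; rewrite -[X in measurable X]setTI; exact: measurable_snd. Qed.

(** Concentration on the leaves turns the restriction to a strip over [B] into the
    restriction of the base integral to [B]; every almost everywhere statement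
    about leaf kernels is read off from this identity. *)
Lemma leaf_kernel_strip (l : set XK -> \bar R) k (E : set XK) (B : set X) :
  leaf_kernel l k -> measurable E -> measurable B ->
  l (E `&` fst @^-1` B) = \int[m]_(x in B) k x E.
Proof.
move=> [mk _ kl lE] mE mB; have mfB := measurable_fst_preimage mB.
rewrite lE; last exact: measurableI.
rewrite [RHS]integral_mkcond; apply: ge0_ae_eq_integral => //.
- by apply: mk; exact: measurableI.
- apply/(measurable_restrictT _ mB).
  apply: measurable_funTS.
  exact: mk.
- by move=> x _; rewrite patchE; case: ifP.
apply: filterS kl => x kx0 _; rewrite patchE.
have k0 (F : set XK) : measurable F -> F `<=` ~` on_leaf x -> k x F = 0.
  move=> mF Fx; apply/eqP; rewrite eq_le measure_ge0 andbT -kx0.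
  by apply: le_measure; rewrite ?inE//; apply: measurableC; exact: measurable_on_leaf.
case: ifPn => [/[!inE] Bx|/negP Bx].
  rewrite -[in RHS](setUIDK E (fst @^-1` B)) measureU//; last 3 first.
  - exact: measurableI.
  - exact: measurableD.
  - by apply/seteqP; split => // z [[_ ?] [_]].
  rewrite [X in _ + X]k0 ?adde0//; first exact: measurableD.
  by move=> [u v] [_ /= nBu] [/= ux _]; apply: nBu; rewrite ux.
rewrite k0//; first exact: measurableI.
by move=> [u v] [_ /= Bu] [/= ux _]; apply: Bx; rewrite inE -ux.
Qed.

Lemma leaf_kernel_marginal (l : set XK -> \bar R) k : leaf_kernel l k ->
  pushforward l fst `<< m.
Proof.
move=> lk; apply/null_content_dominatesP => B mB mB0.
rewrite /pushforward -[X in l X]setTI (leaf_kernel_strip lk)//.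
by rewrite null_set_integral//; apply: measurable_funTS; case: lk => + _ _ _; exact.
Qed.

Lemma leaf_kernel_mass_integrable (l : set XK -> \bar R) k :
  leaf_kernel l k -> l setT < +oo ->
  m.-integrable [set: X] (fun x => k x setT).
Proof.
move=> [mk _ _ lE] lfin; apply/integrableP; split; first exact: mk.
under eq_integral do rewrite gee0_abs//.
by rewrite -lE.
Qed.

Lemma leaf_kernel_density l k : leaf_kernel l k ->
  \forall x \ae m, marginal_density m (charge_of_finite_measure l) x = k x setT.
Proof.
move=> lk; have dom := leaf_kernel_marginal lk.
have [mk _ _ _] := lk.
suff : ae_eq m setT (marginal_density m (charge_of_finite_measure l))
    (fun x => k x setT) by apply: filterS => x; exact.
apply: integral_ae_eq => //.
- exact: Radon_Nikodym_integrable.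
- exact: mk.
move=> B _ mB; rewrite -Radon_Nikodym_integral//.
by rewrite -(leaf_kernel_strip lk)// setTI.
Qed.

(** Normalizing the conditional measures gives the disintegration; where the
    conditional measure is zero an arbitrary probability is used, which is
    harmless since the marginal does not charge those points. *)
Lemma leaf_kernel_disintegration l k : leaf_kernel l k ->
  exists k' : X -> probability XK R, disintegration m l k' /\
    \forall x \ae m, forall B, measurable B ->
      leaf_pos m l k' x B = k x (snd @^-1` B).
Proof.
move=> lk; have [mk kfin kl lE] := lk.
have kfn x E : measurable E -> k x E \is a fin_num.
  move=> mE; rewrite ge0_fin_numE//; apply: le_lt_trans (kfin x).
  by apply: le_measure; rewrite ?inE.
pose kk : R.-ker X ~> XK := HB.pack k (isKernel.Build _ _ _ _ _ k mk).
pose k' : X -> probability XK R := fun x => mnormalize (k x) (dirac point).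
have k'E x E : measurable E -> k' x E * k x setT = k x E.
  move=> mE; rewrite /k' /= /mnormalize.
  have [k0|k0] /= := eqVneq (k x setT) 0.
    rewrite k0 mule0; apply/esym/eqP; rewrite eq_le measure_ge0 andbT -k0.
    by apply: le_measure; rewrite ?inE.
  rewrite (lt_eqF (kfin x)) -muleA -[X in _ * (_ * X)]fineK ?kfn//.
  by rewrite -EFinM mulVf ?mule1// fine_eq0// kfn.
have dens := leaf_kernel_density lk.
have dom := leaf_kernel_marginal lk.
have mk' E : measurable E -> measurable_fun [set: X] (fun x => k' x E).
  move=> mE; have := measurable_kernel
    (knormalize kk (dirac point : probability XK R)) E mE.
  exact.
exists k'; split; first split => //.
- have [N [mN N0 Nsub]] := kl.
  exists (N `|` [set x | k x setT = 0]); split.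
  + apply: measurableU => //; rewrite -[X in measurable X]setTI.
    exact: (mk setT measurableT measurableT [set 0]).
  + have mZ : measurable [set x | k x setT = 0].
      by rewrite -[X in measurable X]setTI; exact: (mk setT measurableT measurableT [set 0]).
    apply/eqP; rewrite /pushforward preimage_setU -measure_le0.
    apply: (@le_trans _ _ (l (fst @^-1` N) + l (fst @^-1` [set x | k x setT = 0]))).
      by apply: measureU2; exact: measurable_fst_preimage.
    have -> : l (fst @^-1` N) = 0 by move/null_content_dominatesP : dom; exact.
    rewrite add0e -[X in l X]setTI (leaf_kernel_strip lk)//.
    by rewrite integral0_eq// => x /=.
  + move=> x /= nx; apply: contrapT => /not_orP[nN k0]; apply: nx.
    have kx : k x (~` on_leaf x) = 0 by apply: contrapT => h; apply: nN; exact: Nsub.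
    rewrite /k' /= /mnormalize (lt_eqF (kfin x)) orbF; case: eqP => // _.
    have -> : k x ([set x] `*` [set: K]) = k x setT.
      rewrite -(setUv (on_leaf x)) measureU//; last 3 first.
      * exact: measurable_on_leaf.
      * apply: measurableC; exact: measurable_on_leaf.
      * by rewrite setICr.
      by rewrite [X in _ + X]kx adde0.
    rewrite -[X in (X * _)]fineK ?kfn// -EFinM divff// fine_eq0 ?kfn//.
    exact/eqP.
- move=> E mE; rewrite lE//; apply: ae_eq_integral => //.
  + exact: (mk _ mE).
  + apply: emeasurable_funM; first exact: mk'.
    exact: measurable_int (Radon_Nikodym_integrable _).
  + by apply: filterS dens => x dx _; rewrite dx k'E.
apply: filterS dens => x dx B mB.
have mB' := measurable_snd_preimage mB.
have -> : leaf_pos m l k' x B = (fine (marginal_density m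
    (charge_of_finite_measure l) x))%:E * k' x (snd @^-1` B) by [].
by rewrite dx fineK ?kfn// muleC k'E.
Qed.

(** The density is replaced by a version that is nonnegative everywhere, so that it
    can scale the conditional probabilities. *)
Lemma disintegration_leaf_kernel l (k : X -> probability XK R) :
  pushforward l fst `<< m -> disintegration m l k ->
  exists k', leaf_kernel l k' /\
    \forall x \ae m, forall B, measurable B ->
      leaf_pos m l k x B = k' x (snd @^-1` B).
Proof.
move=> dom [mk kl lE].
have mfst : measurable_fun [set: XK] (fst : XK -> X) by exact: measurable_fst.
have [f [f0 ffin fint fE]] := @radon_nikodym_sigma_finite _ _ _ m (finite_push l mfst) dom.
have mf := measurable_int _ fint.
have dens : \forall x \ae m, marginal_density m (charge_of_finite_measure l) x = f x.
  suff : ae_eq m setT (marginal_density m (charge_of_finite_measure l)) f.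
    by apply: filterS => x; exact.
  apply: integral_ae_eq => //; first exact: Radon_Nikodym_integrable.
  by move=> B _ mB; rewrite -Radon_Nikodym_integral// -fE.
have fr0 x : (0 <= fine (f x))%R by exact: fine_ge0.
pose k' x : {measure set XK -> \bar R} := mscale (NngNum (fr0 x)) (k x).
have k'E x E : k' x E = f x * k x E by rewrite -[in RHS](fineK (ffin x)).
exists k'; split; first split.
- by move=> E mE; under eq_fun do rewrite k'E; apply: emeasurable_funM => //; exact: (mk _ mE).
- by move=> x; rewrite k'E probability_setT mule1 ltey_eq ffin.
- have [N [mN N0 Nsub]] := kl.
  have fN : ae_eq m N f (cst 0).
    apply/ae_eq_integral_abs => //; first exact: measurable_funTS.
    under eq_integral do rewrite gee0_abs//.
    by rewrite -fE.
  apply: filterS fN => x fx; rewrite k'E.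
  have [Nx|nN] := pselect (N x); first by rewrite fx// mul0e.
  have k1 : k x (on_leaf x) = 1 by apply: contrapT => h; apply: nN; exact: Nsub.
  rewrite probability_setC; last exact: measurable_on_leaf.
  by rewrite k1 subee// mule0.
- move=> E mE; rewrite lE//; apply: ae_eq_integral => //.
  + apply: emeasurable_funM; first exact: mk.
    exact: measurable_int (Radon_Nikodym_integrable _).
  + by under eq_fun do rewrite k'E; apply: emeasurable_funM => //; exact: mk.
  + by apply: filterS dens => x dx _; rewrite dx k'E muleC.
apply: filterS dens => x dx B mB; rewrite k'E -[in RHS](fineK (ffin x)) -dx.
by [].
Qed.

(** If [nu = h l] then [h] times the conditional measures of [l] are conditional
    measures of [nu].  This is how the Jordan parts of an image measure, which are
    dominated by the images of the Jordan parts, get their disintegrations. *)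
Lemma leaf_kernel_dominated l (nu : {finite_measure set XK -> \bar R}) k :
  leaf_kernel l k -> nu `<< l -> exists k', leaf_kernel nu k'.
Proof.
move=> [mk kfin kl lE] nul.
have [h [h0 hfin hint hE]] := @radon_nikodym_sigma_finite _ _ _ l nu nul.
have mh := measurable_int _ hint.
pose q x : {measure set XK -> \bar R} := density_measure (k x) mh h0.
have qE x E : measurable E -> q x E = \int[k x]_z (h z * (\1_E z)%:E).
  by move=> mE; rewrite /q /= /density_measure integral_mkcond epatch_indic.
have mhE E : measurable E -> measurable_fun [set: XK] (fun z => h z * (\1_E z)%:E).
  by move=> mE; apply: emeasurable_funM => //; exact/measurable_EFinP.
have hE0 E z : 0 <= h z * (\1_E z)%:E by rewrite mule_ge0// lee_fin.
have mq E : measurable E -> measurable_fun [set: X] (fun x => q x E).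
  move=> mE; under eq_fun do rewrite qE//.
  exact: (measurable_fun_integral_kernel mk (hE0 E) (mhE E mE)).
have nuE E : measurable E -> nu E = \int[m]_x q x E.
  move=> mE; rewrite hE// integral_mkcond epatch_indic.
  rewrite (integral_mixture mk lE (hE0 E) (mhE E mE)).
  by apply: eq_integral => x _; rewrite qE.
have qfin : \forall x \ae m, q x setT < +oo.
  have iq : m.-integrable [set: X] (fun x => q x setT).
    apply/integrableP; split; first exact: mq.
    under eq_integral do rewrite gee0_abs//.
    by rewrite -nuE// ltey_eq fin_num_measure.
  by have := integrable_ae measurableT iq; apply: filterS => x /(_ I) h1; rewrite ltey_eq h1.
(* [q x] is finite for almost every [x] only; it is replaced by zero elsewhere *)
pose c (x : X) : R := ((q x [set: XK] < +oo)%E)%:R.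
have c0 x : (0 <= c x)%R by rewrite /c; case: (_ < _)%E.
have mc : measurable_fun [set: X] c.
  rewrite (_ : c = \1_((fun x => q x setT) @^-1` [set~ +oo])).
    apply: measurable_indic; rewrite -[X in measurable X]setTI.
    by apply: (mq _ measurableT) => //; exact: measurableC.
  apply/funext => x; rewrite indicE /c ltey; congr ((nat_of_bool _)%:R).
  by apply/idP/idP; rewrite inE/= => /eqP.
pose k' x : {measure set XK -> \bar R} := mscale (NngNum (c0 x)) (q x).
have k'E x E : k' x E = (c x)%:E * q x E by [].
have mk' E : measurable E -> measurable_fun [set: X] (fun x => k' x E).
  move=> mE; under eq_fun do rewrite k'E.
  by apply: emeasurable_funM; [exact/measurable_EFinP|exact: mq].
exists k'; split => //.
- move=> x; rewrite k'E /c; have [qx|_] := boolP (q x setT < +oo).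
    by rewrite mul1e.
  by rewrite mul0e ltry.
- apply: filterS kl => x kx; rewrite k'E [X in _ * X](_ : _ = 0) ?mule0//.
  rewrite /q /= /density_measure null_set_integral//.
    apply: measurableC; exact: measurable_on_leaf.
  exact: measurable_funTS.
- move=> E mE; rewrite nuE//; apply: ae_eq_integral => //; first exact: mq.
    exact: mk'.
  by apply: filterS qfin => x qx _; rewrite k'E /c qx mul1e.
Qed.

(** For each set of a countable pi-system generating the Borel sets, the masses
    agree almost everywhere, because they have the same integral over every base
    set; off a countable union of null sets they agree on the whole pi-system. *)
Lemma leaf_kernel_unique (l1 l2 : set XK -> \bar R) k1 k2 :
  @second_countable K -> l1 setT < +oo ->
  leaf_kernel l1 k1 -> leaf_kernel l2 k2 ->
  (forall E, measurable E -> l1 E = l2 E) ->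
  \forall x \ae m, forall B, measurable B ->
    k1 x (snd @^-1` B) = k2 x (snd @^-1` B).
Proof.
move=> sK l1fin lk1 lk2 l12; have [G [mG Gpi G0]] := second_countable_pi_system sK.
have mGn n : measurable (G n) by rewrite mG; apply: sub_sigma_algebra; exists n.
have H n : \forall x \ae m, k1 x (snd @^-1` G n) = k2 x (snd @^-1` G n).
  have mS := measurable_snd_preimage (mGn n).
  have [mk1 _ _ _] := lk1; have [mk2 _ _ _] := lk2.
  suff : ae_eq m setT (fun x => k1 x (snd @^-1` G n)) (fun x => k2 x (snd @^-1` G n)).
    by apply: filterS => x; exact.
  apply: integral_ae_eq => //.
  - apply: le_integrable (leaf_kernel_mass_integrable lk1 l1fin) => //; first exact: mk1.
    by move=> x _; rewrite !gee0_abs//; apply: le_measure; rewrite ?inE.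
  - exact: mk2.
  - move=> B _ mB; rewrite -(leaf_kernel_strip lk1)// -(leaf_kernel_strip lk2)//.
    by rewrite l12//; apply: measurableI => //; exact: measurable_fst_preimage.
have := ae_foralln H; apply: filterS => x Hx B mB.
have msnd : measurable_fun [set: XK] (snd : XK -> K) by exact: measurable_snd.
pose p (q : {measure set XK -> \bar R}) : {measure set K -> \bar R} :=
  measure_function_pushforward__canonical__measure_function_Measure q msnd.
apply: (@measure_unique _ _ _ (range G) (fun=> G 0%N) mG Gpi _ _ (p (k1 x)) (p (k2 x))) => //.
- by rewrite G0 bigcup_const//; exists 0%N.
- by move=> _ [n _ <-]; exact: Hx.
- by move=> _; rewrite G0; have [_ + _ _] := lk1; exact.
Qed.

Lemma leaf_kernelD (l1 l2 : set XK -> \bar R) k1 k2 :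
  leaf_kernel l1 k1 -> leaf_kernel l2 k2 ->
  exists k, leaf_kernel (l1 \+ l2) k /\ forall x E, k x E = k1 x E + k2 x E.
Proof.
move=> [mk1 f1 c1 E1] [mk2 f2 c2 E2].
pose k x : {measure set XK -> \bar R} := measure_add (k1 x) (k2 x).
have kE x E : k x E = k1 x E + k2 x E by exact: measure_addE.
exists k; split => //; split.
- move=> E mE; under eq_fun do rewrite kE.
  by apply: emeasurable_funD; [exact: mk1|exact: mk2].
- by move=> x; rewrite kE lte_add_pinfty.
- by apply: filterS2 c1 c2 => x c1 c2; rewrite kE c1 c2 adde0.
- move=> E mE; under eq_integral do rewrite kE.
  by rewrite ge0_integralD//; [rewrite -E1// -E2|exact: mk1|exact: mk2].
Qed.

Lemma leaf_kernel_fin_num (l : set XK -> \bar R) k x E :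
  leaf_kernel l k -> measurable E -> k x E \is a fin_num.
Proof.
move=> [_ kfin _ _] mE; rewrite ge0_fin_numE//; apply: le_lt_trans (kfin x).
by apply: le_measure; rewrite ?inE.
Qed.

(** The minimal decomposition of [nu] has its own leaf kernels, dominated by those
    of [l1] and [l2], and uniqueness applied to [nu^+ + l2 = l1 + nu^-] shows that
    their difference is the given one. *)
Lemma jordan_leaf_kernels (nu : {charge set XK -> \bar R})
    (l1 l2 : {finite_measure set XK -> \bar R}) k1 k2 :
  @second_countable K -> leaf_kernel l1 k1 -> leaf_kernel l2 k2 ->
  (forall E, measurable E -> nu E = l1 E - l2 E) ->
  exists k3 k4, [/\ leaf_kernel (jpos nu) k3, leaf_kernel (jneg nu) k4 &
    \forall x \ae m, forall B, measurable B ->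
      k3 x (snd @^-1` B) - k4 x (snd @^-1` B) =
      k1 x (snd @^-1` B) - k2 x (snd @^-1` B)].
Proof.
move=> sK lk1 lk2 nuE.
have p1 : jpos nu `<< l1.
  apply/null_content_dominatesP => E mE E0; apply/eqP; rewrite -measure_le0 -E0.
  by apply: jpos_le => // F mF; rewrite nuE// geeDl// leeNl oppe0.
have p2 : jneg nu `<< l2.
  apply/null_content_dominatesP => E mE E0; apply/eqP; rewrite -measure_le0 -E0.
  apply: jneg_le => // F mF; rewrite nuE//.
  rewrite fin_num_oppeB ?fin_num_measure// addeC geeDl//.
  by rewrite leeNl oppe0.
have [k3 lk3] := leaf_kernel_dominated lk1 p1.
have [k4 lk4] := leaf_kernel_dominated lk2 p2.
exists k3, k4; split => //.
have [k32 [lk32 k32E]] := leaf_kernelD lk3 lk2.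
have [k14 [lk14 k14E]] := leaf_kernelD lk1 lk4.
have h : (jpos nu \+ l2) setT < +oo by rewrite /= ltey_eq fin_numD !fin_num_measure.
have E E' : measurable E' -> (jpos nu \+ l2) E' = (l1 \+ jneg nu) E'.
  move=> mE; apply/fin_num_subE; try exact: fin_num_measure.
  by rewrite -nuE// jordanE.
have := leaf_kernel_unique sK h lk32 lk14 E.
apply: filterS => x H B mB; have mS := measurable_snd_preimage mB.
have fin l k (lk : leaf_kernel l k) := leaf_kernel_fin_num x lk mS.
apply/(fin_num_subE (fin _ _ lk3) (fin _ _ lk4) (fin _ _ lk1) (fin _ _ lk2)).
by rewrite -k32E -k14E H.
Qed.

End leaf_kernels.

(** * Geometry of the one-sided shift *)

Section shift_geometry.
Context (R : realType) (N : nat) (A : 'M[nat]_N.+1) (theta : R).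
Context (Aok : transition_matrix A) (theta01 : 0 < theta < 1).
Local Notation X := (subshift Aok theta01).
Implicit Types x y : X.

Lemma coord_eq x y k : mdist x y < theta ^+ k -> forall i, (i <= k)%N -> x i = y i.
Proof.
case/andP: theta01 => t0 t1 xy i ik; apply: contrapT => /eqP ne.
have : theta ^+ k <= mdist x y.
  apply: le_trans (dtheta_term_le x y i); rewrite /dtheta_term (negbTE ne) subr0 mulr1.
  by apply: ler_wiXn2l => //; exact: ltW.
by rewrite leNgt xy.
Qed.

Lemma mdist_shift_ge x y : x 0%N = y 0%N ->
  mdist x y <= theta * mdist (left_shift x) (left_shift y).
Proof.
case/andP: theta01 => t0 t1 xy0; apply: limr_le; first exact: is_cvg_dtheta.
apply: nearW => -[|n].
  by rewrite /series /= big_geq// mulr_ge0 ?(ltW t0)// mdist_ge0.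
rewrite /series /= big_nat_recl//= {1}/dtheta_term xy0 eqxx subrr mulr0 add0r.
rewrite (eq_bigr (fun i => theta *
    dtheta_term (left_shift x) (left_shift y) i)); last first.
  by move=> i _; rewrite /dtheta_term exprS mulrA.
rewrite -mulr_sumr ler_wpM2l ?(ltW t0)//.
apply: (nondecreasing_cvgn_le _ (@is_cvg_dtheta _ _ _ _ _ _ _ _)).
by apply: nondecreasing_series => i _ _; exact: dtheta_term_ge0.
Qed.

Lemma mdist_le x y : mdist x y <= (1 - theta)^-1.
Proof.
case/andP: theta01 => t0 t1; apply: limr_le; first exact: is_cvg_dtheta.
apply: nearW => n; rewrite /series /=.
apply: (@le_trans _ _ (\sum_(0 <= i < n) theta ^+ i)).
  apply: ler_sum => i _; rewrite /dtheta_term.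
  by case: (_ == _); rewrite ?subrr ?mulr0 ?subr0 ?mulr1// exprn_ge0// ltW.
rewrite big_mkord -[leRHS]mul1r ler_pdivlMr ?subr_gt0//.
have := subrX1 theta n; have : 0 <= theta ^+ n by rewrite exprn_ge0// ltW.
by move=> *; lra.
Qed.

Lemma mdist_cylinder x y n : (forall k, (k < n)%N -> x k = y k) ->
  mdist x y <= theta ^+ n * (1 - theta)^-1.
Proof.
case/andP: theta01 => t0 t1.
elim: n x y => [|n ih] x y xy; first by rewrite mul1r mdist_le.
apply: le_trans (mdist_shift_ge (xy 0%N isT)) _.
rewrite exprS -mulrA ler_wpM2l ?(ltW t0)//; apply: ih => k kn.
exact: xy k.+1 kn.
Qed.

(** The inverse branch of the shift through the symbol [i], extended by the
    identity to the points that [i] cannot precede. *)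
Definition prepend (i : 'I_N.+1) (x : X) : X :=
  match pselect (A i (x 0%N) = 1%N) with
  | left Aix => Subshift Aok theta01
      (coord := fun n => if n is n'.+1 then x n' else i)
      (fun n => match n with 0%N => Aix | n'.+1 => coordP x n' end)
  | right _ => x
  end.

Lemma prepend0 i x : A i (x 0%N) = 1%N -> prepend i x 0%N = i.
Proof. by rewrite /prepend; case: pselect. Qed.

Lemma prependS i x n : A i (x 0%N) = 1%N -> prepend i x n.+1 = x n.
Proof. by rewrite /prepend; case: pselect. Qed.

Lemma shift_prepend i x : A i (x 0%N) = 1%N -> left_shift (prepend i x) = x.
Proof. by move=> Aix; apply: subshift_ext => n /=; exact: prependS. Qed.

Lemma mdist_prepend i x y : x 0%N = y 0%N -> A i (x 0%N) = 1%N ->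
  mdist (prepend i x) (prepend i y) <= theta * mdist x y.
Proof.
move=> xy Aix; have Aiy : A i (y 0%N) = 1%N by rewrite -xy.
apply: le_trans (mdist_shift_ge _) _; first by rewrite !prepend0.
by rewrite !shift_prepend.
Qed.

(** At distance less than [1] two points share their first letter, so that both
    or neither can be preceded by [i]. *)
Lemma continuous_prepend i : continuous (prepend i).
Proof.
case/andP: (theta01) => t0 t1 x V /nbhs_ballP[e /= e0 eV].
apply/nbhs_ballP; exists (Num.min 1 e) => /=; first by rewrite lt_min ltr01.
move=> y; rewrite ballEmdist /= lt_min => /andP[xy1 xye].
apply: eV; rewrite ballEmdist /=.
have xy : x 0%N = y 0%N by apply: (@coord_eq _ _ 0%N).
have [Aix|nA] := pselect (A i (x 0%N) = 1%N).
  apply: le_lt_trans (mdist_prepend xy Aix) _; apply: le_lt_trans xye.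
  by rewrite ler_piMl ?mdist_ge0// ltW.
rewrite /prepend; case: pselect => // _; case: pselect => // Aiy.
by exfalso; apply: nA; rewrite xy.
Qed.

Lemma measurable_prepend i : measurable_fun [set: X] (prepend i).
Proof. exact/borel_continuous_measurable/continuous_prepend. Qed.

Lemma measurable_coord0 (f : 'I_N.+1 -> R) :
  measurable_fun [set: X] (fun x => f (x 0%N)).
Proof.
apply: borel_continuous_measurableR => x V nV.
apply/nbhs_ballP; exists 1 => //= y; rewrite ballEmdist /= => xy.
by rewrite -(@coord_eq x y 0%N xy 0%N)//; exact: nbhs_singleton nV.
Qed.

Definition word_cylinder (s : seq 'I_N.+1) : set X :=
  [set x | forall k, (k < size s)%N -> x k = nth ord0 s k].

Lemma open_word_cylinder s : open (word_cylinder s).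
Proof.
case/andP: (theta01) => t0 t1; rewrite openE => x xs; apply/nbhs_ballP.
exists (theta ^+ size s) => /=; first exact: exprn_gt0.
move=> y; rewrite ballEmdist /= => xy k ks.
by rewrite -(coord_eq xy (ltnW ks)); exact: xs.
Qed.

(** Words of length one are left out so that removing the first letter of a word
    leaves a nonempty word; the branch weights are constant on its cylinder. *)
Definition cylinders : set (set X) :=
  [set set0; setT] `|` [set word_cylinder s | s in [set s | (1 < size s)%N]].

Lemma cylinders_setI : setI_closed cylinders.
Proof.
have cc s t : (1 < size s)%N -> (1 < size t)%N -> (size s <= size t)%N ->
    cylinders (word_cylinder s `&` word_cylinder t).
  move=> s1 t1 st.
  have [->|/set0P[x [xs xt]]] := eqVneq (word_cylinder s `&` word_cylinder t) set0.
    by left; left.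
  right; exists t => //; apply/seteqP; split => [y yt|y []//]; split => // k ks.
  by rewrite -xs// xt ?yt// (leq_trans ks).
move=> B C [[->|->]|[s s1 <-]]; first by rewrite set0I; left; left.
  by rewrite setTI.
move=> [[->|->]|[t t1 <-]]; first by rewrite setI0; left; left.
  by rewrite setIT; right; exists s.
have [st|/ltnW ts] := leqP (size s) (size t); first exact: cc.
by rewrite setIC; exact: cc.
Qed.

(** There are countably many words, and the cylinders around a point have diameters
    tending to zero; so every open set is a countable union of cylinders. *)
Lemma borel_cylinders : (measurable : set (set X)) = <<s cylinders >>.
Proof.
case/andP: (theta01) => t0 t1.
apply/seteqP; split; last first.
  apply: smallest_sub; first exact: smallest_sigma_algebra.
  move=> C [[->|->]|[s _ <-]].
  - by apply: sub_sigma_algebra; exact: open0.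
  - by apply: sub_sigma_algebra; exact: openT.
  - by apply: sub_sigma_algebra; exact: open_word_cylinder.
rewrite measurable_borelE.
apply: smallest_sub; first exact: smallest_sigma_algebra.
move=> U oU.
pose e n : set X := if unpickle n is Some s then
  if (1 < size (s : seq 'I_N.+1))%N && `[< word_cylinder s `<=` U >]
  then word_cylinder s else set0 else set0.
have -> : U = \bigcup_n e n.
  apply/seteqP; split => [x Ux|x [n _]]; last first.
    rewrite /e; case: unpickle => [s|]//; case: ifPn => // /andP[_ /asboolP sU].
    exact: sU.
  have /nbhs_ballP[r /= r0 rU] : nbhs x U by exact: open_nbhs_nbhs.
  have [n nr] : exists n, theta ^+ n * (1 - theta)^-1 < r.
    have /cvgrPdist_lt/(_ _ r0) : geometric (1 - theta)^-1 theta @ \oo --> (0 : R).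
      by apply: cvg_geometric; rewrite ger0_norm ?ltW.
    move=> [n _ /(_ n (leqnn n))]; rewrite /= sub0r normrN => nr.
    by exists n; rewrite mulrC (le_lt_trans _ nr)// ler_norm.
  pose s := mkseq x n.+2.
  have xs : word_cylinder s x.
    by move=> k; rewrite size_mkseq => ks; rewrite nth_mkseq.
  have sU : word_cylinder s `<=` U.
    move=> y ys; apply: rU; rewrite ballEmdist /=; apply: le_lt_trans nr.
    apply: mdist_cylinder => k kn.
    have kn2 : (k < n.+2)%N by rewrite ltnW// ltnW.
    by rewrite ys ?size_mkseq// nth_mkseq.
  exists (pickle s) => //; rewrite /e pickleK size_mkseq /=.
  by case: asboolP.
apply: (@bigcupT_measurable _ (g_sigma_algebraType cylinders)) => n.
apply: sub_sigma_algebra; rewrite /e; case: unpickle => [s|]; last by left; left.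
case: ifPn => [/andP[s1 _]|_]; last by left; left.
by right; exists s.
Qed.

End shift_geometry.

(** * Time reversal of the Markov measure *)

Section reversed_chain.
Context (R : realType) (N : nat) (A : 'M[nat]_N.+1) (theta : R).
Context (Aok : transition_matrix A) (theta01 : 0 < theta < 1).
Local Notation X := (subshift Aok theta01).
Variables (m : probability X R) (P : 'M[R]_N.+1) (p : 'rV[R]_N.+1).
Hypothesis hm : markov_measure P p m.

Lemma markov_pow_ge0 k i j : 0 <= (P ^+ k) i j.
Proof.
have [[P0 _] _ _ _ _] := hm; elim: k i j => [|k ih] i j.
  by rewrite expr0 mxE ler0n.
by rewrite exprS -mulmxE mxE sumr_ge0// => l _; rewrite mulr_ge0.
Qed.

Lemma markov_pow_gt0 k i j : (0 < (A ^+ k) i j)%N -> 0 < (P ^+ k) i j.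
Proof.
have [[P0 _] PA _ _ _] := hm; have [A01 _] := Aok.
elim: k i j => [|k ih] i j.
  by rewrite !expr0 !mxE; case: (i == j) => //= _; exact: ltr01.
rewrite !exprS -!mulmxE !mxE lt0n sum_nat_eq0 negb_forall => /existsP[l /=].
rewrite muln_eq0 negb_or => /andP[Ail Akl].
rewrite (bigD1 l)//= ltr_pwDl//; last first.
  by apply: sumr_ge0 => l' _; rewrite mulr_ge0// markov_pow_ge0.
rewrite mulr_gt0//; last by apply: ih; rewrite lt0n.
apply/PA; have := A01 i l; rewrite !inE => /orP[/eqP h|/eqP//].
by rewrite h in Ail.
Qed.

Lemma stationary_pow k : p *m P ^+ k = p.
Proof.
have [_ _ _ pP _] := hm.
by elim: k => [|k ih]; rewrite ?expr0 ?mulmx1// exprS -mulmxE mulmxA pP.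
Qed.

(** A stationary vector is stationary for all powers of [P], one of which is
    positive. *)
Lemma stationary_gt0 j : 0 < p 0 j.
Proof.
have [_ _ [p0 p1] _ _] := hm; have [_ [k _ Ak]] := Aok.
have [i pi0] : exists i, p 0 i != 0.
  apply: contrapT => none.
  have z i : p 0 i = 0.
    by apply/eqP; apply: contrapT => /negP ?; apply: none; exists i.
  by move: p1; rewrite (eq_bigr (fun=> 0)) ?big1// => /eqP; rewrite eq_sym oner_eq0.
rewrite -(stationary_pow k) mxE (bigD1 i)//= ltr_pwDl//.
  by rewrite mulr_gt0 ?markov_pow_gt0// lt_def pi0 p0.
by apply: sumr_ge0 => l _; rewrite mulr_ge0// markov_pow_ge0.
Qed.

(** Transition probabilities of the time-reversed chain, from [j] to [i]. *)
Definition reversed : 'M[R]_N.+1 := \matrix_(j, i) (p 0 i * P i j / p 0 j).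
Local Notation Q := reversed.

Lemma reversed_ge0 j i : 0 <= Q j i.
Proof.
have [[P0 _] _ [p0 _] _ _] := hm.
by rewrite mxE divr_ge0// mulr_ge0.
Qed.

Lemma reversed_sum j : \sum_i Q j i = 1.
Proof.
have [_ _ _ pP _] := hm.
under eq_bigr do rewrite mxE.
rewrite -mulr_suml (_ : \sum_i _ = p 0 j) ?divff// ?gt_eqF ?stationary_gt0//.
by rewrite -[in RHS]pP mxE.
Qed.

Lemma reversed_adm j i : Q j i != 0 -> A i j = 1%N.
Proof.
have [[P0 _] PA _ _ _] := hm; rewrite mxE => Qn0; apply/PA.
rewrite lt_def P0 andbT; apply: contraNneq Qn0 => ->.
by rewrite mulr0 mul0r.
Qed.

Lemma reversed_pow k j i : (Q ^+ k) j i = p 0 i * (P ^+ k) i j / p 0 j.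
Proof.
have pn0 l : p 0 l != 0 by rewrite gt_eqF ?stationary_gt0.
elim: k j i => [|k ih] j i.
  rewrite !expr0 !mxE eq_sym; case: eqP => [->|_] /=; first by rewrite mulr1 divff.
  by rewrite mulr0 mul0r.
rewrite exprS exprSr -!mulmxE !mxE mulr_sumr mulr_suml; apply: eq_bigr => l _.
rewrite ih mxE; field.
by rewrite !pn0.
Qed.

Lemma reversed_pow_sum k j : \sum_i (Q ^+ k) j i = 1.
Proof.
elim: k j => [|k ih] j.
  rewrite expr0; under eq_bigr do rewrite mxE.
  by rewrite (bigD1 j)//= eqxx big1 ?addr0// => i /negbTE; rewrite eq_sym => ->.
rewrite exprS -mulmxE; under eq_bigr do rewrite mxE.
rewrite exchange_big /=; under eq_bigr do rewrite -mulr_sumr ih mulr1.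
exact: reversed_sum.
Qed.

(** Time reversal conjugates [P] to the transpose of [reversed] by the positive
    vector [p], so [reversed] inherits a power with positive entries. *)
Lemma reversed_doeblin : exists k delta, [/\ (0 < k)%N, 0 < delta,
  forall j i, delta <= (Q ^+ k) j i & (N.+1)%:R * delta <= 1].
Proof.
have [_ [k k0 Ak]] := Aok; exists k.
pose F (ij : 'I_N.+1 * 'I_N.+1) : R := (Q ^+ k) ij.1 ij.2.
pose delta : R := \big[Order.min/1]_ij F ij.
have dQ j i : delta <= (Q ^+ k) j i by exact: (bigmin_le _ (j, i) F).
exists delta; split => //.
  apply/bigmin_gtP; split => // -[j i] _ /=.
  by rewrite /F reversed_pow divr_gt0 ?mulr_gt0 ?stationary_gt0 ?markov_pow_gt0.
rewrite -[leRHS](reversed_pow_sum k ord0) mulr_natl.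
rewrite -[N.+1 in leLHS]card_ord -sumr_const; apply: ler_sum => i _; exact: dQ.
Qed.

Local Open Scope ereal_scope.

Local Notation cyl := (@word_cylinder _ _ _ _ Aok theta01).

Lemma measurable_word_cylinder s : measurable (cyl s).
Proof. exact/borel_openT/open_word_cylinder. Qed.

Lemma markov_word_cylinder a s : m (cyl (a :: s)) =
  (p 0%R a * \prod_(k < size s) P (nth ord0 (a :: s) k) (nth ord0 s k))%:E.
Proof.
have [_ _ _ _ mC] := hm; rewrite -(mC (size s) (nth ord0 (a :: s))).
by congr (m _); apply/seteqP; split => x xs k; exact: xs.
Qed.

Lemma prepend_cylinder a b s (x : X) : A a (x 0%N) = 1%N ->
  cyl [:: a, b & s] (prepend a x) <-> cyl (b :: s) x.
Proof.
move=> Aax; split => xs k ks; first by rewrite -(@prependS _ _ _ _ _ _ a)// xs.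
case: k ks => [|k] ks; first by rewrite prepend0.
by rewrite prependS// xs.
Qed.

(** On the cylinder of [b :: s] the weight of the branch [a] is the constant
    [p a * P a b / p b], which turns the measure of that cylinder into the measure
    of the cylinder of [a :: b :: s]. *)
Lemma integral_prepend_cylinder (a b i : 'I_N.+1) (s : seq 'I_N.+1) :
  \int[m]_(x in prepend i @^-1` cyl [:: a, b & s]) (Q (x 0%N) i)%:E =
  if i == a then m (cyl [:: a, b & s]) else 0.
Proof.
have [->{i}|ia] := eqVneq i a; last first.
  rewrite integral0_eq// => x /= xs; congr EFin.
  have [Aix|nA] := pselect (A i (x 0%N) = 1%N).
    by have := xs 0%N isT; rewrite prepend0//= => ia'; rewrite ia' eqxx in ia.
  by apply: contrapT => /eqP /reversed_adm.
transitivity (\int[m]_(x in cyl (b :: s)) (Q b a)%:E).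
  rewrite integral_mkcond [RHS]integral_mkcond; apply: eq_integral => x _.
  rewrite !patchE.
  have [Aax|nA] := pselect (A a (x 0%N) = 1%N).
    have h := prepend_cylinder b s Aax.
    case: ifPn => [/[!inE]/= /h xs|nxs].
      by rewrite mem_set//; have /= -> := xs 0%N isT.
    by rewrite memNset// => /h xs; move/negP: nxs; apply; rewrite inE.
  have Q0 : Q (x 0%N) a = 0%R by apply: contrapT => /eqP /reversed_adm.
  rewrite Q0 if_same; case: ifPn => // /[!inE] xs.
  by have /= xb := xs 0%N isT; rewrite -xb Q0.
rewrite integral_cst; last exact: measurable_word_cylinder.
transitivity ((Q b a)%:E * m (cyl (b :: s))) => //.
rewrite !markov_word_cylinder -EFinM; congr EFin => /=.
rewrite big_ord_recl /= mxE.
have pb : p 0%R b != 0%R by rewrite gt_eqF ?stationary_gt0.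
by field.
Qed.

Lemma measurable_reversed i :
  measurable_fun [set: X] (fun x : X => (Q (x 0%N) i)%:E).
Proof.
apply/measurable_EFinP.
exact: (@measurable_coord0 _ _ _ _ Aok theta01 (fun j => Q j i)).
Qed.

Let branch_part (i : 'I_N.+1) : {measure set X -> \bar R} :=
  measure_function_pushforward__canonical__measure_function_Measure
    (density_measure m (measurable_reversed i)
       (fun x => reversed_ge0 (x 0%N) i : 0 <= (Q (x 0%N) i)%:E))
    (@measurable_prepend _ _ _ _ Aok theta01 i).

Lemma measure_transfer E : measurable E ->
  m E = \sum_(i < N.+1) \int[m]_(x in prepend i @^-1` E) (Q (x 0%N) i)%:E.
Proof.
move=> mE; pose M : {measure set X -> \bar R} :=
  msum (fun n => branch_part (inord n)) N.+1.
have ME B : M B = \sum_(i < N.+1) \int[m]_(x in prepend i @^-1` B) (Q (x 0%N) i)%:E.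
  by apply: eq_bigr => i _; rewrite inord_val.
rewrite -ME.
apply: (@measure_unique _ _ _ (@cylinders _ _ _ _ Aok theta01) (fun=> setT)
  (borel_cylinders Aok theta01) (@cylinders_setI _ _ _ _ Aok theta01) _ _ m M) => //.
- by move=> _; left; right.
- by rewrite bigcup_const//; exists 0%N.
- move=> B [[->|->]|[[|a [|b s]] //= _ <-]].
  + by rewrite !measure0.
  + transitivity (M setT) => //; rewrite ME.
    under eq_bigr do rewrite preimage_setT.
    rewrite -ge0_integral_sum//; last 2 first.
    * by move=> i; exact: measurable_reversed.
    * by move=> i x _; exact: reversed_ge0.
    under eq_integral do rewrite sumEFin reversed_sum.
    by rewrite integral_cst// mul1e.
  + transitivity (M (cyl [:: a, b & s])) => //; rewrite ME.
    under eq_bigr do rewrite integral_prepend_cylinder.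
    by rewrite -big_mkcond big_pred1_eq.
- by move=> _; apply: (le_lt_trans (probability_le1 m measurableT)); rewrite ltry.
Qed.

(** The conditional law of a point given its image [x] under the shift. *)
Definition preimage_law (x : X) : {measure set X -> \bar R} :=
  msum (fun n => mscale (NngNum (reversed_ge0 (x 0%N) (inord n)))
                        (dirac (prepend (inord n) x))) N.+1.

Lemma preimage_lawE x E : preimage_law x E =
  \sum_(i < N.+1) (Q (x 0%N) i)%:E * (\1_E (prepend i x))%:E.
Proof. by apply: eq_bigr => i _; rewrite /mscale /= inord_val. Qed.

Lemma measurable_preimage_law E : measurable E ->
  measurable_fun [set: X] (fun x => preimage_law x E).
Proof.
move=> mE; under eq_fun do rewrite preimage_lawE.
apply: emeasurable_sum => i; apply: emeasurable_funM; first exact: measurable_reversed.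
apply/measurable_EFinP; apply: measurableT_comp; last exact: measurable_prepend.
exact: measurable_indic.
Qed.

Lemma mixture_preimage_law E : measurable E -> m E = \int[m]_x preimage_law x E.
Proof.
move=> mE; rewrite measure_transfer//.
under [RHS]eq_integral do rewrite preimage_lawE.
rewrite ge0_integral_sum//; last 2 first.
- move=> i; apply: emeasurable_funM; first exact: measurable_reversed.
  apply/measurable_EFinP; apply: measurableT_comp; last exact: measurable_prepend.
  exact: measurable_indic.
- by move=> i x _; rewrite mule_ge0// lee_fin// reversed_ge0.
apply: eq_bigr => i _; rewrite [LHS]integral_mkcond.
by apply: eq_integral => x _; rewrite epatch_indic.
Qed.

(** Invariance of [m] under the shift, in the form of the duality that defines the
    transfer operator. *)
Lemma integral_transfer (f : X -> \bar R) : measurable_fun [set: X] f ->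
  (forall x, 0 <= f x) ->
  \int[m]_x f x = \int[m]_x \sum_(i < N.+1) (Q (x 0%N) i)%:E * f (prepend i x).
Proof.
move=> mf f0; rewrite (integral_mixture measurable_preimage_law mixture_preimage_law f0 mf).
apply: eq_integral => x _; rewrite ge0_integral_measure_sum//.
apply: eq_bigr => i _; rewrite ge0_integral_mscale// integral_dirac//.
by rewrite diracT mul1e inord_val.
Qed.

(** A null set has null preimages under the inverse branches, where these have
    positive weight: integrate its indicator with [integral_transfer]. *)
Lemma ae_prepend (S : X -> Prop) : (\forall x \ae m, S x) ->
  \forall x \ae m, forall i, Q ((x : X) 0%N) i != 0%R -> S (prepend i x).
Proof.
move=> [Z [mZ Z0 ZS]].
have m1 : measurable_fun [set: X] (fun y : X => (\1_Z y)%:E : \bar R).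
  by apply/measurable_EFinP; exact: measurable_indic.
have p1 y : 0 <= (\1_Z y)%:E :> \bar R by rewrite lee_fin.
have h : \int[m]_x (\1_Z (x : X))%:E = 0.
  by rewrite integral_indic// setIT; exact: Z0.
rewrite (integral_transfer m1 p1) in h.
have mg : measurable_fun [set: X] (fun x : X => \sum_(i < N.+1)
     (Q (x 0%N) i)%:E * (\1_Z (prepend i x))%:E).
  apply: emeasurable_sum => i; apply: emeasurable_funM; first exact: measurable_reversed.
  by apply: measurableT_comp m1 _; exact: measurable_prepend.
have g0 i (x : X) : 0 <= (Q (x 0%N) i)%:E * (\1_Z (prepend i x))%:E :> \bar R.
  by rewrite mule_ge0// lee_fin// reversed_ge0.
have : ae_eq m setT (fun x : X => \sum_(i < N.+1)
     (Q (x 0%N) i)%:E * (\1_Z (prepend i x))%:E) (cst 0).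
  apply/ae_eq_integral_abs => //.
  by rewrite -[RHS]h; apply: eq_integral => x _; rewrite gee0_abs// sume_ge0.
apply: filterS => x /(_ I) /= gx i Qi; apply: contrapT => nS.
have Zx : Z (prepend i x) by exact: ZS.
have : (Q (x 0%N) i)%:E * (\1_Z (prepend i x))%:E <= 0 :> \bar R.
  by rewrite -gx (bigD1 i)//= leeDl// sume_ge0.
rewrite indicE mem_set// mule1 lee_fin leNgt => /negP; apply.
by rewrite lt_def Qi reversed_ge0.
Qed.

End reversed_chain.

(** * Decay of the transfer operator *)

Section transfer_decay.
Context (R : realType) (N : nat) (A : 'M[nat]_N.+1) (theta : R).
Context (Aok : transition_matrix A) (theta01 : 0 < theta < 1).
Local Notation X := (subshift Aok theta01).
Variables (m : probability X R) (P : 'M[R]_N.+1) (p : 'rV[R]_N.+1).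
Hypothesis hm : markov_measure P p m.
Local Notation Q := (reversed P p).
Implicit Types (f : X -> R) (x y : X).

(** The Perron-Frobenius operator of the shift. *)
Definition transfer f x : R := \sum_i Q (x 0%N) i * f (prepend i x).

Lemma transfer_between (a b : R) f :
  (forall x, a <= f x <= b) -> forall x, a <= transfer f x <= b.
Proof.
move=> fab x; rewrite -[a]mul1r -[b]mul1r -(reversed_sum hm (x 0%N)) !mulr_suml.
by apply/andP; split; apply: ler_sum => i _; rewrite ler_wpM2l ?(reversed_ge0 hm)//;
  have /andP[] := fab (prepend i x).
Qed.

Lemma iter_transfer_between n (a b : R) f :
  (forall x, a <= f x <= b) -> forall x, a <= iter n transfer f x <= b.
Proof. by move=> fab; elim: n => //= n; exact: transfer_between. Qed.

(** The Lipschitz condition is restricted to points with the same first letter,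
    over which the weights of the inverse branches are constant; this makes the
    contraction by [theta] exact, with no additional error term. *)
Definition letterwise_lipschitz (v : R) f :=
  forall x y, x 0%N = y 0%N -> `|f x - f y| <= v * mdist x y.

Lemma transfer_letterwise_lipschitz v f : 0 <= v ->
  letterwise_lipschitz v f -> letterwise_lipschitz (theta * v) (transfer f).
Proof.
case/andP: (theta01) => t0 t1 v0 fv x y xy; rewrite /transfer -xy -sumrB.
apply: le_trans (ler_norm_sum _ _ _) _.
rewrite -[leRHS]mul1r -(reversed_sum hm (x 0%N)) mulr_suml; apply: ler_sum => i _.
rewrite -mulrBr normrM ger0_norm ?(reversed_ge0 hm)//.
have [->|Qi] := eqVneq (Q (x 0%N) i) 0; first by rewrite !mul0r.
have Aix := reversed_adm hm Qi; have Aiy : A i (y 0%N) = 1%N by rewrite -xy.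
rewrite ler_wpM2l ?(reversed_ge0 hm)//; apply: le_trans (fv _ _ _) _.
  by rewrite !prepend0.
by rewrite [theta * v]mulrC -mulrA ler_wpM2l//; exact: mdist_prepend.
Qed.

Lemma iter_transfer_letterwise_lipschitz n v f : 0 <= v ->
  letterwise_lipschitz v f -> letterwise_lipschitz (theta ^+ n * v) (iter n transfer f).
Proof.
case/andP: (theta01) => t0 t1 v0 fv; elim: n => [|n ih]; first by rewrite mul1r.
rewrite exprS -mulrA; apply: transfer_letterwise_lipschitz => //.
by rewrite mulr_ge0// exprn_ge0// ltW.
Qed.

Lemma word_point (j : 'I_N.+1) : exists x : X, x 0%N = j.
Proof.
have := markov_word_cylinder hm j [::]; rewrite big_ord0 mulr1.
have := stationary_gt0 hm j => pj mj; apply: contrapT => none.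
have : @word_cylinder _ _ _ _ Aok theta01 [:: j] = set0.
  by apply/seteqP; split => // x /(_ 0%N isT) /= xj; apply: none; exists x.
move=> c0; move: mj; rewrite c0 measure0 => -[pj0].
by rewrite -pj0 ltxx in pj.
Qed.

(** Each row of the matrix is [delta] times the constant row [1] plus a nonnegative
    row of mass [1 - (N + 1) delta]; the first part gives the same value in every
    row. *)
Lemma doeblin_oscillation k delta (u : 'I_N.+1 -> R) (a w : R) :
  (forall j i, delta <= (Q ^+ k) j i) -> (forall j, a <= u j <= a + w) ->
  exists a', forall j, a' <= \sum_i (Q ^+ k) j i * u i
                       <= a' + (1 - (N.+1)%:R * delta) * w.
Proof.
move=> dQ ua; set s := 1 - _.
exists (delta * (\sum_i u i) + s * a) => j.
have E : \sum_i (Q ^+ k) j i * u i =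
    delta * (\sum_i u i) + \sum_i ((Q ^+ k) j i - delta) * u i.
  by rewrite mulr_sumr -big_split /=; apply: eq_bigr => i _; ring.
have S : \sum_i ((Q ^+ k) j i - delta) = s.
  by rewrite /s sumrB (reversed_pow_sum hm) sumr_const card_ord mulr_natl.
rewrite E -addrA -mulrDr !lerD2l -S !mulr_suml.
by apply/andP; split; apply: ler_sum => i _; rewrite ler_wpM2l ?subr_ge0//;
  have /andP[] := ua i.
Qed.

(** On functions of the first letter the transfer operator acts as the matrix
    [reversed], and it does not increase the distance to such functions. *)
Lemma iter_transfer_letters k f (u : 'I_N.+1 -> R) (e : R) :
  (forall x, `|f x - u (x 0%N)| <= e) ->
  forall x, `|iter k transfer f x - \sum_i (Q ^+ k) (x 0%N) i * u i| <= e.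
Proof.
move=> fu; elim: k => [|k ih] x.
  rewrite expr0 (bigD1 (x 0%N))//= mxE eqxx mul1r big1 ?addr0//.
  by move=> i /negbTE; rewrite mxE eq_sym => ->; rewrite mul0r.
have -> : \sum_i (Q ^+ k.+1) (x 0%N) i * u i =
    \sum_l Q (x 0%N) l * (\sum_i (Q ^+ k) l i * u i).
  under eq_bigr do rewrite exprS -mulmxE mxE mulr_suml.
  rewrite exchange_big /=; apply: eq_bigr => l _.
  by rewrite mulr_sumr; apply: eq_bigr => i _; rewrite mulrA.
rewrite iterS /transfer -sumrB; apply: le_trans (ler_norm_sum _ _ _) _.
rewrite -[e]mul1r -(reversed_sum hm (x 0%N)) mulr_suml; apply: ler_sum => l _.
rewrite -mulrBr normrM ger0_norm ?(reversed_ge0 hm)//.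
have [->|Ql] := eqVneq (Q (x 0%N) l) 0; first by rewrite !mul0r.
rewrite ler_wpM2l ?(reversed_ge0 hm)//.
by have := ih (prepend l x); rewrite prepend0//; exact: (reversed_adm hm Ql).
Qed.

Definition oscillation_le (w : R) f := exists a, forall x, a <= f x <= a + w.

Lemma oscillation_block k delta f (v w : R) : 0 <= v ->
  (forall j i, delta <= (Q ^+ k) j i) ->
  letterwise_lipschitz v f -> oscillation_le w f ->
  oscillation_le ((1 - (N.+1)%:R * delta) * w + 2 * (1 - theta)^-1 * v)
    (iter k transfer f).
Proof.
move=> v0 dQ fv [a fa]; have [r r0] := choice word_point.
set e := (1 - theta)^-1 * v.
have fu x : `|f x - f (r (x 0%N))| <= e.
  apply: le_trans (fv _ _ _) _; first by rewrite r0.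
  by rewrite /e mulrC ler_wpM2r// mdist_le.
have [a' ua'] := doeblin_oscillation dQ (fun j => fa (r j)).
exists (a' - e) => x.
have := @iter_transfer_letters k f (f \o r) e fu x; have := ua' (x 0%N).
rewrite ler_norml /= => /andP[? ?] /andP[? ?].
have -> : 2 * (1 - theta)^-1 * v = 2 * e by rewrite mulrA.
by apply/andP; split; lra.
Qed.

Lemma bernoulli_ge (x : R) k : 0 <= x <= 1 -> 1 - k%:R * x <= (1 - x) ^+ k.
Proof.
move=> /andP[x0 x1]; elim: k => [|k ih]; first by rewrite mul0r subr0.
rewrite exprS; apply: (@le_trans _ _ ((1 - x) * (1 - k%:R * x))).
  have h : 0 <= k%:R * (x * x) :> R by rewrite !mulr_ge0.
  by rewrite -natr1; move: h; set kr := k%:R; lra.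
by rewrite ler_wpM2l// subr_ge0.
Qed.

(** The oscillations [w_n] of the iterates satisfy
    [w_(n+k) <= s w_n + B theta^n v] with [s < 1].  This recursion preserves the
    bound [w_n <= C r^n (v + w_0)] as soon as [theta <= r] and
    [C s + B <= C r^k], and [1 <= C r^k] gives it for the first [k] terms. *)
Lemma oscillation_decay : exists C r : R, [/\ 0 <= C, 0 < r < 1 &
  forall f v w n, 0 <= v -> 0 <= w -> letterwise_lipschitz v f -> oscillation_le w f ->
    oscillation_le (C * r ^+ n * (v + w)) (iter n transfer f)].
Proof.
case/andP: (theta01) => t0 t1.
have [k [delta [k0 d0 dQ Nd]]] := reversed_doeblin hm.
set s := 1 - (N.+1)%:R * delta.
have s0 : 0 <= s by rewrite subr_ge0.
have s1 : s < 1 by rewrite ltrBlDr ltrDl mulr_gt0.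
pose B := 2 * (1 - theta)^-1.
have B0 : 0 <= B by rewrite mulr_ge0// invr_ge0 subr_ge0 ltW.
have kR0 : 0 < k%:R :> R by rewrite ltr0n.
have kR1 : 1 <= k%:R :> R by rewrite ler1n.
(* by Bernoulli's inequality [(1 - z)^k] is at least [(1 + s) / 2 > s] *)
pose z := (1 - s) / 2 / k%:R.
have z0 : 0 < z by rewrite !divr_gt0// subr_gt0.
have z1 : z < 1.
  rewrite ltr_pdivrMr// mul1r; apply: lt_le_trans kR1; lra.
pose r := Num.max theta (1 - z).
have r0 : 0 < r by rewrite lt_max t0.
have r1 : r < 1 by rewrite gt_max t1 ltrBlDr ltrDl.
have rt : theta <= r by rewrite le_max lexx.
have rk : s < r ^+ k.
  apply: (@lt_le_trans _ _ ((1 - z) ^+ k)); last first.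
    by apply: lerXn2r; rewrite ?nnegrE ?(ltW r0) ?subr_ge0 ?(ltW z1)// le_max lexx orbT.
  apply: (@lt_le_trans _ _ (1 - k%:R * z)); last by apply: bernoulli_ge; rewrite !ltW.
  have -> : k%:R * z = (1 - s) / 2 by rewrite /z mulrC divfK// gt_eqF.
  by lra.
have rks : 0 < r ^+ k - s by rewrite subr_gt0.
pose C := (1 + B) / (r ^+ k - s).
have C0 : 0 <= C by rewrite divr_ge0 ?(ltW rks)//; lra.
have CE : C * r ^+ k = C * s + 1 + B.
  have : C * (r ^+ k - s) = 1 + B by rewrite /C divfK// gt_eqF.
  by rewrite mulrBr; lra.
exists C, r; split; rewrite ?r0//.
move=> f v w n v0 w0 fv fw; elim/ltn_ind: n => n ih.
have vw0 : 0 <= v + w by exact: addr_ge0.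
have [nk|kn] := ltnP n k.
  have [a fa] := fw; exists a => x.
  have /andP[-> fxw] /= := iter_transfer_between n fa x.
  apply: le_trans fxw _; rewrite lerD2l.
  apply: (@le_trans _ _ (1 * (v + w))); first by rewrite mul1r lerDr.
  rewrite ler_wpM2r//; apply: (@le_trans _ _ (C * r ^+ k)).
    by rewrite CE; have := mulr_ge0 C0 s0; lra.
  by rewrite ler_wpM2l//; apply: ler_wiXn2l; rewrite ?(ltW r0) ?(ltW r1)// ltnW.
have nE : n = (k + (n - k))%N by rewrite subnKC.
set l := (n - k)%N in nE; rewrite nE iterD.
have lv := iter_transfer_letterwise_lipschitz l v0 fv.
have ll : (l < n)%N by rewrite nE -[X in (X < _)%N]add0n ltn_add2r.
have tlv : 0 <= theta ^+ l * v by rewrite mulr_ge0// exprn_ge0// ltW.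
have [a fa] := oscillation_block tlv dQ lv (ih l ll).
exists a => x; have /andP[-> h] /= := fa x.
apply: le_trans h _; rewrite lerD2l -/s -/B.
have tr : theta ^+ l <= r ^+ l by apply: lerXn2r; rewrite ?nnegrE ?(ltW t0) ?(ltW r0).
have rl : 0 <= r ^+ l by rewrite exprn_ge0// ltW.
have h1 : B * (theta ^+ l * v) <= B * (r ^+ l * (v + w)).
  rewrite ler_wpM2l// ler_pM// ?exprn_ge0 ?(ltW t0)//.
  by rewrite lerDl.
have h2 : 0 <= r ^+ l * (v + w) by exact: mulr_ge0.
set q := r ^+ l * (v + w) in h1 h2.
have -> : C * r ^+ (k + l) * (v + w) = s * (C * q) + q + B * q.
  by rewrite exprD mulrA CE /q; ring.
have -> : s * (C * r ^+ l * (v + w)) = s * (C * q) by rewrite /q; ring.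
by rewrite lerD// lerDl.
Qed.

End transfer_decay.

(** * Contraction on one leaf *)

Section leaf_contraction.
Context (R : realType) d dK (Z : measurableType d) (K : borelMetricType dK R).
Variables (pr : Z -> K) (mpr : measurable_fun [set: Z] pr).

(** The test functions in the definition of the dual norm. *)
Definition Wtest (g : K -> R) :=
  (forall x y, `|g x - g y| <= mdist x y) /\ (forall x, `|g x| <= 1).

Lemma Lipschitz_measurable c (g : K -> R) :
  (forall x y, `|g x - g y| <= c * mdist x y) -> measurable_fun [set: K] g.
Proof. by move=> /lipschitz_continuous /borel_continuous_measurableR. Qed.

Lemma Wtest_measurable g : Wtest g -> measurable_fun [set: K] g.
Proof.
by move=> [gl _]; apply: (@Lipschitz_measurable 1) => x y; rewrite mul1r.
Qed.

(** Write [h = h (y0) + alpha g]; since the diameter of [K] is at most [1], [g] is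
    bounded by [1], hence a test function, and only the constant [h (y0)] sees the
    total masses. *)
Lemma contracted_test_bound (n1 n2 : {measure set Z -> \bar R})
    (alpha M S : R) (h : K -> R) :
  0 < alpha -> (forall x y : K, mdist x y <= 1) ->
  (n1 setT < +oo)%E -> (n2 setT < +oo)%E ->
  (forall g, Wtest g ->
     `|\int[n1]_z g (pr z) - \int[n2]_z g (pr z)| <= M) ->
  `|fine (n1 setT) - fine (n2 setT)| <= S ->
  (forall x y, `|h x - h y| <= alpha * mdist x y) ->
  (forall x, `|h x| <= 1) ->
  `|\int[n1]_z h (pr z) - \int[n2]_z h (pr z)| <= alpha * M + S.
Proof.
move=> a0 diamK f1 f2 WM mS hl h1.
pose c := h point; pose g x := alpha^-1 * (h x - c).
have gW : Wtest g.
  split => [x y|x].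
    rewrite /g -mulrBr opprB addrA subrK normrM ger0_norm ?invr_ge0 ?(ltW a0)//.
    by rewrite ler_pdivrMl// mulrC [leRHS]mulrC mulrC.
  rewrite /g normrM ger0_norm ?invr_ge0 ?(ltW a0)// ler_pdivrMl// mulr1.
  by apply: le_trans (hl _ _) _; rewrite ler_piMr// ltW.
have mg : measurable_fun [set: Z] (g \o pr).
  exact: measurableT_comp (Wtest_measurable gW) mpr.
have key (n : {measure set Z -> \bar R}) : (n setT < +oo)%E ->
    \int[n]_z h (pr z) = alpha * \int[n]_z g (pr z) + c * fine (n setT).
  move=> nfin.
  have ig : n.-integrable setT (EFin \o (g \o pr)).
    by apply: (@bounded_integrable _ _ _ n _ 1) => // z; exact: gW.2.
  have ic : n.-integrable setT (EFin \o cst c).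
    by apply: (@bounded_integrable _ _ _ n _ `|c|).
  rewrite -RintegralZl// -(@Rintegral_cst _ _ _ n setT measurableT c).
  rewrite -RintegralD//.
  - by apply: eq_Rintegral => z _; rewrite /g mulrA divff ?gt_eqF// mul1r subrK.
  - apply: (@bounded_integrable _ _ _ n _ alpha) => //.
      exact: (measurable_funM (measurable_cst alpha) mg).
    by move=> z; rewrite normrM (gtr0_norm a0) ler_piMr ?(ltW a0)//; exact: gW.2.
rewrite (key n1)// (key n2)//.
rewrite (_ : _ - _ = alpha * (\int[n1]_z g (pr z) - \int[n2]_z g (pr z)) +
   c * (fine (n1 setT) - fine (n2 setT))); last by ring.
apply: le_trans (ler_normD _ _) _; apply: lerD.
  by rewrite normrM (gtr0_norm a0) ler_wpM2l ?(ltW a0)// WM.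
rewrite normrM; apply: le_trans mS; rewrite ler_piMl//; exact: h1.
Qed.

End leaf_contraction.

(** * Disintegration of the image measure *)

Section push_kernel.
Context (R : realType) (N : nat) (A : 'M[nat]_N.+1) (theta : R).
Context (Aok : transition_matrix A) (theta01 : 0 < theta < 1).
Local Notation X := (subshift Aok theta01).
Variables (m : probability X R) (P : 'M[R]_N.+1) (p : 'rV[R]_N.+1).
Hypothesis hm : markov_measure P p m.
Context dK (K : borelMetricType dK R) (G : {mfun (X * K)%type >-> K}).
Local Notation Q := (reversed P p).
Local Notation XK := (X * K)%type.
Local Notation FG := (Defs.skew G).
Local Notation mF := (measurable_skew G).
Implicit Types (k : X -> {measure set XK -> \bar R}) (x : X).
Local Open Scope ereal_scope.

Definition push_kernel k x : {measure set XK -> \bar R} :=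
  msum (fun n => mscale (NngNum (reversed_ge0 hm (x 0%N) (inord n)))
    (measure_function_pushforward__canonical__measure_function_Measure
      (k (prepend (inord n) x)) mF : {measure set XK -> \bar R})) N.+1.

Lemma push_kernelE k x E : push_kernel k x E =
  \sum_(i < N.+1) (Q (x 0%N) i)%:E * k (prepend i x) (FG @^-1` E).
Proof. by apply: eq_bigr => i _; rewrite /mscale /= inord_val. Qed.

Lemma measurable_skew_preimage (E : set XK) :
  measurable E -> measurable (FG @^-1` E).
Proof. by move=> mE; rewrite -[X in measurable X]setTI; exact: mF. Qed.

(** The skew product maps the leaf over [i x] into the leaf over [x], and the
    duality [integral_transfer] moves the base integral along the shift. *)
Lemma leaf_kernel_push (l : {finite_measure set XK -> \bar R}) k :
  leaf_kernel m l k -> leaf_kernel m (finite_push l mF) (push_kernel k).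
Proof.
move=> [mk kfin kl lE]; split.
- move=> E mE; under eq_fun do rewrite push_kernelE.
  apply: emeasurable_sum => i; apply: emeasurable_funM; first exact: measurable_reversed.
  apply: (measurableT_comp (mk _ (measurable_skew_preimage mE))).
  exact: measurable_prepend.
- move=> x; rewrite push_kernelE; apply: lte_sum_pinfty => i _.
  by rewrite preimage_setT lte_mul_pinfty// lee_fin// (reversed_ge0 hm).
- apply: filterS (ae_prepend hm kl) => x kx; rewrite push_kernelE.
  rewrite big1// => i _; have [->|Qi] := eqVneq (Q (x 0%N) i) 0%R; first by rewrite mul0e.
  rewrite [X in _ * X](_ : _ = 0) ?mule0//.
  apply/eqP; rewrite -measure_le0 -(kx i Qi); apply: le_measure; rewrite ?inE//.
  + apply: measurable_skew_preimage; apply: measurableC; exact: measurable_on_leaf.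
  + by apply: measurableC; exact: measurable_on_leaf.
  + move=> z /= nz; apply: contra_not nz => -[/= z1 _]; split => //=.
    by rewrite z1 shift_prepend//; exact: (reversed_adm hm Qi).
- move=> E mE; rewrite [LHS](_ : _ = l (FG @^-1` E))//.
  rewrite lE; last exact: measurable_skew_preimage.
  rewrite (integral_transfer hm)//; last exact: (mk _ (measurable_skew_preimage mE)).
  by apply: eq_integral => x _; rewrite push_kernelE.
Qed.

Lemma integral_push_kernel k x (f : XK -> R) (c : R) :
  (forall y, k y setT < +oo) -> measurable_fun [set: XK] f ->
  (forall z, `|f z| <= c)%R ->
  (\int[push_kernel k x]_z f z =
   \sum_(i < N.+1) Q (x 0%N) i * \int[k (prepend i x)]_z f (FG z))%R.
Proof.
move=> kfin mf fc.
have mfF : measurable_fun [set: XK] (f \o FG) by exact: measurableT_comp mf mF.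
have pos (g : XK -> \bar R) : measurable_fun [set: XK] g -> (forall z, 0 <= g z) ->
    \int[push_kernel k x]_z g z =
    \sum_(i < N.+1) (Q (x 0%N) i)%:E * \int[k (prepend i x)]_z g (FG z).
  move=> mg g0; rewrite ge0_integral_measure_sum//; apply: eq_bigr => i _.
  rewrite ge0_integral_mscale// inord_val; congr (_ * _).
  exact: (ge0_integral_pushforward mF _ measurableT mg).
have ifin i : (k (prepend i x)).-integrable setT (EFin \o (f \o FG)).
  by apply: (@bounded_integrable _ _ _ _ _ c) => // z; exact: fc.
have mfE : measurable_fun [set: XK] (EFin \o f) by exact/measurable_EFinP.
pose fF z := (f (FG z))%:E.
have fp i : \int[k (prepend i x)]_z fF^\+ z \is a fin_num.
  exact: (integrable_fin_num measurableT (integrable_funepos measurableT (ifin i))).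
have fn i : \int[k (prepend i x)]_z fF^\- z \is a fin_num.
  exact: (integrable_fin_num measurableT (integrable_funeneg measurableT (ifin i))).
have cp i : \int[k (prepend i x)]_z (EFin \o f)^\+ (FG z) =
    \int[k (prepend i x)]_z fF^\+ z.
  by apply: eq_integral => z _; rewrite !funeposE.
have cn i : \int[k (prepend i x)]_z (EFin \o f)^\- (FG z) =
    \int[k (prepend i x)]_z fF^\- z.
  by apply: eq_integral => z _; rewrite !funenegE.
rewrite {1}/Rintegral integralE (pos _ (measurable_funepos mfE))//.
rewrite (pos _ (measurable_funeneg mfE))//.
transitivity (fine (\sum_(i < N.+1)
    (Q (x 0%N) i * \int[k (prepend i x)]_z f (FG z))%R%:E)); last first.
  by rewrite sumEFin.
congr fine; rewrite -sumeN; last first.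
  by move=> i j _ _; rewrite fin_num_adde_defl// fin_numM// cn.
rewrite -big_split /=; apply: eq_bigr => i _.
rewrite EFinM /Rintegral fineK; last exact: (integrable_fin_num measurableT (ifin i)).
have -> : \int[k (prepend i x)]_z fF z =
    \int[k (prepend i x)]_z fF^\+ z - \int[k (prepend i x)]_z fF^\- z.
  exact: integralE.
rewrite [RHS]muleBr//; last exact: fin_num_adde_defr.
by rewrite -cp -cn.
Qed.

End push_kernel.

(** * Dual norms of the leaves *)

Section leaf_norm.
Context (R : realType) dX dK (X : borelMetricType dX R)
  (K : borelMetricType dK R) (m : probability X R).
Local Notation XK := (X * K)%type.

Lemma charge_integral_leaf (nu : {charge set K -> \bar R})
    (n1 n2 : {measure set XK -> \bar R}) (g : K -> R) :
  (n1 setT < +oo)%E -> (n2 setT < +oo)%E ->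
  (forall B, measurable B -> nu B = n1 (snd @^-1` B) - n2 (snd @^-1` B))%E ->
  Wtest g ->
  charge_integral nu g = (\int[n1]_z g z.2 - \int[n2]_z g z.2)%:E.
Proof.
move=> f1 f2 nuE gW; have mg := Wtest_measurable gW; have [_ g1] := gW.
have msnd : measurable_fun [set: XK] (snd : XK -> K) by exact: measurable_snd.
pose q (n : {measure set XK -> \bar R}) : {measure set K -> \bar R} :=
  measure_function_pushforward__canonical__measure_function_Measure n msnd.
rewrite (@charge_integralB _ _ _ nu (q n1) (q n2) g 1)//.
have qE (n : {measure set XK -> \bar R}) : (n setT < +oo)%E ->
    (\int[q n]_x (g x)%:E = (\int[n]_z g z.2)%:E)%E.
  move=> nfin.
  have ig : n.-integrable setT (EFin \o (g \o snd)).
    apply: (@bounded_integrable _ _ _ n _ 1) => //.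
      exact: measurableT_comp mg msnd.
    by move=> z; exact: g1.
  rewrite /Rintegral fineK; last exact: (integrable_fin_num measurableT ig).
  rewrite (integral_pushforward msnd)//.
  exact/measurable_EFinP.
by rewrite !qE// EFinB.
Qed.

Lemma Wnorm_leP (nu : {charge set K -> \bar R}) (M : \bar R) :
  (Wnorm nu <= M)%E <-> (forall g, Wtest g -> (`|charge_integral nu g| <= M)%E).
Proof.
split=> [WM g gW|gM].
  by apply: le_trans WM; apply: ereal_sup_ubound; exists g.
by apply: ge_ereal_sup => _ [g gW <-]; exact: gM.
Qed.

Lemma Wnorm_ge0 (nu : {charge set K -> \bar R}) : (0 <= Wnorm nu)%E.
Proof.
apply: (le_trans (abse_ge0 (charge_integral nu (cst 0)))).
apply: ereal_sup_ubound; exists (cst 0) => //; split => x *.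
  by rewrite subrr normr0 mdist_ge0.
by rewrite normr0 ler01.
Qed.

Lemma Linf_norm_ge0 (mu : {charge set XK -> \bar R}) : (0 <= Linf_norm m mu)%E.
Proof.
apply: le_ereal_inf_tmp => _ [kp _ [kn _ <-]].
have m0 : (0 < m [set: X])%E by rewrite probability_setT lte01.
apply: (ess_sup_gee m0).
by apply: nearW => x; exact: Wnorm_ge0.
Qed.

Lemma leafE (mu : {charge set XK -> \bar R}) kp kn x B :
  leaf m mu kp kn x B =
  (leaf_pos m (jpos mu) kp x B - leaf_pos m (jneg mu) kn x B)%E.
Proof. by []. Qed.

(** The function [phi] is a density of the marginal of [mu], stated on the masses of
    the leaves.  The leaf kernels are part of the notion because they carry the
    absolute continuity of both Jordan parts from one iterate to the next. *)
Definition has_density (mu : {charge set XK -> \bar R}) (phi : X -> R) :=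
  exists k1 k2, [/\ leaf_kernel m (jpos mu) k1, leaf_kernel m (jneg mu) k2 &
    \forall x \ae m, (k1 x setT = k2 x setT + (phi x)%:E)%E].

(** Integrating the gap over the base would separate the total masses by [a]. *)
Lemma leaf_mass_gap (l1 l2 : {finite_measure set XK -> \bar R}) k1 k2 (a : R) :
  leaf_kernel m l1 k1 -> leaf_kernel m l2 k2 -> l1 setT = l2 setT ->
  (\forall x \ae m, (k2 x setT + a%:E <= k1 x setT)%E) -> a <= 0.
Proof.
move=> [mk1 _ _ E1] [mk2 _ _ E2] l12 gap; rewrite leNgt; apply/negP => a0.
have : (l2 setT + a%:E <= l1 setT)%E.
  rewrite E1// E2// (_ : a%:E = \int[m]_x (cst a%:E x))%E; last first.
    rewrite integral_cst//; transitivity (a%:E * m [set: X])%E => //.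
    by rewrite probability_setT mule1.
  rewrite -ge0_integralD//; last 2 first.
  - exact: mk2.
  - by move=> x _; rewrite lee_fin ltW.
  apply: ae_ge0_le_integral => //.
  - by move=> x _; rewrite adde_ge0// lee_fin ltW.
  - by apply: emeasurable_funD => //; exact: mk2.
  - exact: mk1.
  - by apply: filterS gap => x ? _.
by rewrite l12 leNgt lteDl ?fin_num_measure// lte_fin a0.
Qed.

Lemma has_density_bounds (mu : {charge set XK -> \bar R}) phi (a b : R) : mu setT = 0%E ->
  has_density mu phi -> (forall x, a <= phi x <= b) -> a <= 0 <= b.
Proof.
move=> mu0 [k1 [k2 [lk1 lk2 kphi]]] ab.
have mu12 : jpos mu setT = jneg mu setT.
  have := jordanE mu measurableT; rewrite mu0 => /esym/eqP.
  by rewrite sube_eq ?fin_num_measure// ?fin_num_adde_defl ?fin_num_measure// add0e => /eqP.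
apply/andP; split.
  apply: (leaf_mass_gap lk1 lk2) => //; apply: filterS kphi => x ->.
  by rewrite leeD2l// lee_fin; have /andP[] := ab x.
rewrite -oppr_le0; apply: (leaf_mass_gap lk2 lk1) => //; apply: filterS kphi => x ->.
rewrite -addeA -EFinD geeDl// lee_fin subr_le0; by have /andP[] := ab x.
Qed.

Lemma has_density_AB (mu : {charge set XK -> \bar R}) phi : has_density mu phi -> AB m mu.
Proof.
by move=> [k1 [k2 [lk1 lk2 _]]]; split; apply: leaf_kernel_marginal; eassumption.
Qed.

End leaf_norm.

(** * One iteration of the skew product *)

Section step.
Context (R : realType) (N : nat) (A : 'M[nat]_N.+1) (theta : R).
Context (Aok : transition_matrix A) (theta01 : 0 < theta < 1).
Local Notation X := (subshift Aok theta01).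
Variables (m : probability X R) (P : 'M[R]_N.+1) (p : 'rV[R]_N.+1).
Hypothesis hm : markov_measure P p m.
Context dK (K : borelMetricType dK R) (G : {mfun (X * K)%type >-> K}).
Hypotheses (Kcompact : compact [set: K]) (diamK : forall x y : K, mdist x y <= 1).
Variable alpha : R.
Hypothesis alpha01 : 0 < alpha < 1.
Hypothesis Gcontr : \forall x \ae m, forall y1 y2 : K,
  mdist (G (x, y1)) (G (x, y2)) <= alpha * mdist y1 y2.
Local Notation XK := (X * K)%type.
Local Notation Q := (reversed P p).

Lemma integral_on_leaf (n : {measure set XK -> \bar R}) (y : X) (g : K -> R) :
  measurable_fun [set: K] g -> n (~` on_leaf y) = 0%E ->
  \int[n]_z g (G z) = \int[n]_z g (G (y, z.2)).
Proof.
move=> mg ny; congr fine.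
have mG : measurable_fun [set: XK] (G : XK -> K) by exact: measurable_funPT.
apply: ae_eq_integral => //.
- by apply/measurable_EFinP; exact: measurableT_comp mg mG.
- apply/measurable_EFinP; apply: measurableT_comp mg _.
  apply: measurableT_comp mG _.
  by apply: measurable_fun_pair => //; exact: measurable_snd.
- exists (~` on_leaf y); split => //.
    by apply: measurableC; exact: measurable_on_leaf.
  move=> z /= nz [zy _]; apply: nz => _.
  by case: z zy => u v /= ->.
Qed.

Lemma leaf_push_bound (n1 n2 : {measure set XK -> \bar R}) (y : X) (M S : R) :
  (n1 setT < +oo)%E -> (n2 setT < +oo)%E ->
  n1 (~` on_leaf y) = 0%E -> n2 (~` on_leaf y) = 0%E ->
  (forall y1 y2 : K, mdist (G (y, y1)) (G (y, y2)) <= alpha * mdist y1 y2) ->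
  (forall g, Wtest g -> `|\int[n1]_z g z.2 - \int[n2]_z g z.2| <= M) ->
  `|fine (n1 setT) - fine (n2 setT)| <= S ->
  forall g, Wtest g -> `|\int[n1]_z g (G z) - \int[n2]_z g (G z)| <= alpha * M + S.
Proof.
case/andP: alpha01 => a0 a1 f1 f2 c1 c2 Gy WM mS g gW.
have mg := Wtest_measurable gW; have [gl g1] := gW.
have msnd : measurable_fun [set: XK] (snd : XK -> K) by exact: measurable_snd.
rewrite (integral_on_leaf mg c1) (integral_on_leaf mg c2).
apply: (contracted_test_bound (h := fun u => g (G (y, u))) msnd a0) => //.
by move=> u v; apply: le_trans (gl _ _) _.
Qed.

Lemma F_starE (mu : {charge set XK -> \bar R}) E :
  F_star G mu E = mu (Defs.skew G @^-1` E).
Proof. by []. Qed.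

Lemma F_star_jordan (mu : {charge set XK -> \bar R}) (E : set XK) :
  measurable E -> (F_star G mu E =
    finite_push (jpos mu) (measurable_skew G) E -
    finite_push (jneg mu) (measurable_skew G) E)%E.
Proof. by move=> mE; rewrite F_starE jordanE//; exact: measurable_skew_preimage. Qed.

Lemma sum_reversed_le x (a : 'I_N.+1 -> R) (b : R) :
  (forall i, Q (x : 'I_N.+1) i != 0 -> a i <= b) -> \sum_i Q x i * a i <= b.
Proof.
move=> ab; rewrite -[leRHS]mul1r -(reversed_sum hm x) mulr_suml.
apply: ler_sum => i _; have [->|Qi] := eqVneq (Q x i) 0; first by rewrite !mul0r.
by rewrite ler_wpM2l ?(reversed_ge0 hm)// ab.
Qed.

(** The leaves of the image are compared with the pushed leaves on the whole of
    [K], where pushing does not change masses. *)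
Lemma has_density_F_star (mu : {charge set XK -> \bar R}) phi :
  has_density m mu phi -> has_density m (F_star G mu) (transfer P p phi).
Proof.
move=> [k1 [k2 [lk1 lk2 kphi]]].
have lp1 := leaf_kernel_push hm G lk1; have lp2 := leaf_kernel_push hm G lk2.
have [k3 [k4 [lk3 lk4 k34]]] := jordan_leaf_kernels
  (compact_second_countable Kcompact) lp1 lp2 (@F_star_jordan mu).
exists k3, k4; split => //.
apply: filterS2 k34 (ae_prepend hm kphi) => x H kx.
have := H setT measurableT; rewrite !preimage_setT.
set r1 := push_kernel hm G k1 x setT; set r2 := push_kernel hm G k2 x setT.
have -> : (r1 = r2 + (transfer P p phi x)%:E)%E.
  rewrite /r1 /r2 !push_kernelE !preimage_setT.
  rewrite /transfer -sumEFin -big_split /=; apply: eq_bigr => i _.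
  have [->|Qi] := eqVneq (Q (x 0%N) i) 0; first by rewrite !mul0e mul0r adde0.
  by rewrite kx// muleDr ?EFinM// fin_num_adde_defl.
have r2f : r2 \is a fin_num by exact: (leaf_kernel_fin_num x lp2).
have f3 : k3 x setT \is a fin_num by exact: (leaf_kernel_fin_num x lk3).
have f4 : k4 x setT \is a fin_num by exact: (leaf_kernel_fin_num x lk4).
rewrite addeAC subee// add0e => <-.
by rewrite addeC subeK.
Qed.

(** The norm is an infimum over disintegrations: from a nearly optimal one for [mu]
    a disintegration of the image is built whose leaves are, almost everywhere,
    averages of pushed leaves of [mu]. *)
Lemma Linf_norm_F_star (mu : {charge set XK -> \bar R}) phi (M S : R) :
  has_density m mu phi -> (forall x, `|phi x| <= S) ->
  (Linf_norm m mu <= M%:E)%E -> (Linf_norm m (F_star G mu) <= (alpha * M + S)%:E)%E.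
Proof.
case/andP: (alpha01) => a0 a1 dmu phiS muM; apply/lee_addgt0Pr => e e0.
have [AB1 AB2] := has_density_AB dmu.
have : (Linf_norm m mu < (M + e)%:E)%E.
  by apply: le_lt_trans muM _; rewrite lte_fin ltrDl.
move=> /ereal_inf_lt[_ [kp dkp [kn dkn <-]] /ltW/ess_supP WM].
have [k1 [lk1 kp1]] := disintegration_leaf_kernel AB1 dkp.
have [k2 [lk2 kn2]] := disintegration_leaf_kernel AB2 dkn.
have kphi : \forall x \ae m, (k1 x setT = k2 x setT + (phi x)%:E)%E.
  have [k1' [k2' [lk1' lk2' kphi']]] := dmu.
  have h1 := leaf_kernel_density lk1; have h1' := leaf_kernel_density lk1'.
  have h2 := leaf_kernel_density lk2; have h2' := leaf_kernel_density lk2'.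
  apply: filterS3 kphi' (filterI h1 h1') (filterI h2 h2').
  move=> x kx [e1 e1'] [e2 e2'].
  have -> : k1 x setT = k1' x setT by exact: etrans (esym e1) e1'.
  by have -> : k2 x setT = k2' x setT by exact: etrans (esym e2) e2'.
have lp1 := leaf_kernel_push hm G lk1; have lp2 := leaf_kernel_push hm G lk2.
have [k3 [k4 [lk3 lk4 k34]]] := jordan_leaf_kernels
  (compact_second_countable Kcompact) lp1 lp2 (@F_star_jordan mu).
have [kp' [dkp' kp3]] := leaf_kernel_disintegration lk3.
have [kn' [dkn' kn4]] := leaf_kernel_disintegration lk4.
apply: (@le_trans _ _ (ess_sup m (fun x => Wnorm (leaf m (F_star G mu) kp' kn' x)))).
  by apply: ereal_inf_lbound; exists kp' => //; exists kn'.
apply/ess_supP.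
have [_ k1fin c1 _] := lk1; have [_ k2fin c2 _] := lk2.
have [_ p1fin _ _] := lp1; have [_ p2fin _ _] := lp2.
pose good (y : X) := forall g, Wtest g ->
  `|\int[k1 y]_z g (G z) - \int[k2 y]_z g (G z)| <= alpha * (M + e) + S.
have good_ae : \forall y \ae m, good y.
  near=> y => g gW.
  apply: (leaf_push_bound (y := y)) => //.
  - by near: y.
  - by near: y.
  - by near: y.
  - move=> h hW; rewrite -lee_fin.
    have leafy : forall B, measurable B ->
        (leaf m mu kp kn y B = k1 y (snd @^-1` B) - k2 y (snd @^-1` B))%E.
      move=> B mB; rewrite leafE; congr (_ - _)%E; move: B mB; near: y.
        exact: kp1.
      exact: kn2.
    have := charge_integral_leaf (k1fin y) (k2fin y) leafy hW.
    move=> ch; rewrite -abse_EFin -ch.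
    have Wy : (Wnorm (leaf m mu kp kn y) <= (M + e)%:E)%E by near: y.
    exact: (Wnorm_leP _ _).1 Wy h hW.
  - have : (k1 y setT = k2 y setT + (phi y)%:E)%E by near: y.
    move=> ->; rewrite fineD//; last exact: (leaf_kernel_fin_num y lk2).
    pose u : R := fine (k2 y [set: XK]); change (`|u + phi y - u| <= S).
    by rewrite addrAC subrr add0r.
near=> x.
apply/Wnorm_leP => g gW.
have leafx : forall B, measurable B -> (leaf m (F_star G mu) kp' kn' x B =
    push_kernel hm G k1 x (snd @^-1` B) - push_kernel hm G k2 x (snd @^-1` B))%E.
  move=> B mB; have <- : (k3 x (snd @^-1` B) - k4 x (snd @^-1` B) =
    push_kernel hm G k1 x (snd @^-1` B) - push_kernel hm G k2 x (snd @^-1` B))%E.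
    by move: B mB; near: x.
  by rewrite leafE; congr (_ - _)%E; move: B mB; near: x; [exact: kp3|exact: kn4].
rewrite (charge_integral_leaf (p1fin x) (p2fin x) leafx gW) -EFinD abse_EFin lee_fin.
have mgs : measurable_fun [set: XK] (g \o snd).
  exact: measurableT_comp (Wtest_measurable gW) measurable_snd.
have gs1 (z : XK) : `|(g \o snd) z| <= 1 by exact: gW.2.
have -> := integral_push_kernel hm G x k1fin mgs gs1.
have -> := integral_push_kernel hm G x k2fin mgs gs1.
rewrite -sumrB.
apply: (@le_trans _ _ (\sum_i Q (x 0%N) i *
    `|\int[k1 (prepend i x)]_z g (G z) - \int[k2 (prepend i x)]_z g (G z)|)).
  apply: le_trans (ler_norm_sum _ _ _) _; apply: ler_sum => i _.
  by rewrite -mulrBr normrM ger0_norm ?(reversed_ge0 hm).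
have goodx : forall i, Q (x 0%N) i != 0 -> good (prepend i x).
  by near: x; exact: (ae_prepend hm good_ae).
apply: (@le_trans _ _ (alpha * (M + e) + S)).
  by apply: sum_reversed_le => i Qi; exact: goodx.
have ae : alpha * e <= e by rewrite ler_piMl ?ltW.
by rewrite mulrDr; lra.
Unshelve. all: by end_near.
Qed.

End step.

(** * Densities of the measures of mean zero *)

Section initial_density.
Context (R : realType) dX dK (X : borelMetricType dX R)
  (K : borelMetricType dK R) (m : probability X R).
Local Notation XK := (X * K)%type.
Implicit Type mu : {charge set XK -> \bar R}.

Lemma AB_marginal mu : AB m mu -> push measurable_fst mu `<< m.
Proof.
move=> [/null_content_dominatesP d1 /null_content_dominatesP d2].
apply/null_content_dominatesP => B mB B0.
rewrite /push /= /pushforward jordanE; last exact: measurable_fst_preimage.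
by have := d1 B mB B0; have := d2 B mB B0; rewrite /pushforward => -> ->; rewrite subee.
Qed.

(** If the density has no Lipschitz version, the default value of the choice is the
    density itself. *)
Lemma phi1_density mu : AB m mu ->
  \forall x \ae m, marginal_density m mu x = (phi1 m mu x)%:E.
Proof.
move=> /AB_marginal dom; rewrite /phi1; case: xgetP => [phi _ [_ h]|_].
  by apply: filterS h => x /(_ I).
by apply: nearW => x /=; rewrite fineK// Radon_Nikodym_fin_num.
Qed.

Lemma Sinf_has_density mu : Sinf m mu -> has_density m mu (phi1 m mu).
Proof.
move=> [[mAB mfin] mLip]; have [AB1 AB2] := mAB; have dom := AB_marginal mAB.
have [_ [kp dkp [kn dkn _]] _] := ereal_inf_lt mfin.
have [k1 [lk1 _]] := disintegration_leaf_kernel AB1 dkp.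
have [k2 [lk2 _]] := disintegration_leaf_kernel AB2 dkn.
exists k1, k2; split => //.
have fin (l : {finite_measure set XK -> \bar R}) : (l setT < +oo)%E.
  by rewrite ltey_eq fin_num_measure.
have i1 := leaf_kernel_mass_integrable lk1 (fin _).
have i2 := leaf_kernel_mass_integrable lk2 (fin _).
have H : ae_eq m setT (marginal_density m mu) (fun x => k1 x setT - k2 x setT)%E.
  apply: integral_ae_eq => //; first exact: Radon_Nikodym_integrable.
    by apply: emeasurable_funB; [exact: measurable_int i1|exact: measurable_int i2].
  move=> B _ mB; rewrite -Radon_Nikodym_integral//.
  rewrite integralB//; [|exact: integrableS i1|exact: integrableS i2].
  rewrite -(leaf_kernel_strip lk1)// -(leaf_kernel_strip lk2)// !setTI.
  by rewrite /push /= /pushforward jordanE//; exact: measurable_fst_preimage.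
apply: filterS2 H (phi1_density mAB) => x /(_ I) e1 e2.
have f2 : k2 x setT \is a fin_num by exact: (leaf_kernel_fin_num x lk2).
by rewrite -e2 e1 addeC subeK.
Qed.

Lemma lip_constP (T : metricType R) (f : T -> R) : Lip f ->
  forall x y, `|f x - f y| <= fine (lip_const f) * mdist x y.
Proof.
move=> fL x y; have ub u v : ((`|f u - f v| / mdist u v)%:E <= lip_const f)%E.
  by apply: ereal_sup_ubound; exists u => //; exists v.
have ffin : lip_const f \is a fin_num.
  rewrite ge0_fin_numE//; apply: le_trans (ub x y).
  by rewrite lee_fin divr_ge0// mdist_ge0.
have [->|xy] := eqVneq x y; first by rewrite subrr normr0 mdistxx mulr0.
have d0 : 0 < mdist x y.
  rewrite lt_def mdist_ge0 andbT; apply: contra_neq xy; exact: mdist_positivity.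
by rewrite -ler_pdivrMr// -lee_fin fineK.
Qed.

Lemma lip_const_ge0 (T : metricType R) (x : T) (f : T -> R) : (0 <= lip_const f)%E.
Proof.
apply: (@le_trans _ _ (`|f x - f x| / mdist x x)%:E).
  by rewrite lee_fin divr_ge0// mdist_ge0.
by apply: ereal_sup_ubound; exists x => //; exists x.
Qed.

Lemma sup_norm_ub (T : Type) (f : T -> R) x : (`|f x|%:E <= sup_norm f)%E.
Proof. by apply: ereal_sup_ubound; exists x. Qed.

Lemma Vspace_mass0 mu : Vspace m mu -> mu setT = 0%E.
Proof.
move=> [[[mAB _] mLip] P0]; have dom := AB_marginal mAB.
have mphi : measurable_fun [set: X] (phi1 m mu).
  exact: Lipschitz_measurable (lip_constP mLip).
have E : (mu setT = \int[m]_x (phi1 m mu x)%:E)%E.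
  rewrite [LHS](_ : _ = push measurable_fst mu setT)//.
  rewrite (Radon_Nikodym_integral dom)//; apply: ae_eq_integral => //.
  - exact/measurable_EFinP.
  - by apply: filterS (phi1_density mAB) => x e _.
have mufin : mu setT \is a fin_num by exact: fin_num_measure.
rewrite -(fineK mufin) E; congr EFin.
by have := congr1 (fun f => f point) P0.
Qed.

End initial_density.

(** * Exponential convergence to zero *)

Unset Implicit Arguments.

Theorem proposition5p9 (R : realType) (N : nat) (A : 'M[nat]_N.+1) (theta : R)
    (Aok : transition_matrix A) (theta01 : 0 < theta < 1)
    (m : probability (subshift Aok theta01) R)
    (P : 'M[R]_N.+1) (p : 'rV[R]_N.+1) (hm : markov_measure P p m)
    (dK : measure_display) (K : borelMetricType dK R)
    (Kcompact : compact [set: K]) (Kdiam : diam K = 1%E)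
    (G : {mfun (subshift Aok theta01 * K)%type >-> K})
    (alpha : R) (alpha01 : 0 < alpha < 1)
    (Gcontr : \forall x \ae m, forall y1 y2 : K,
       mdist (G (x, y1)) (G (x, y2)) <= alpha * mdist y1 y2) :
  exists D2 beta1 : R, 0 < beta1 < 1 /\
    forall mu, Vspace m mu -> forall n : nat, (1 <= n)%N ->
      (Linf_norm m (iter n (F_star G) mu) <=
         (D2 * beta1 ^+ n)%:E * Sinf_norm m mu)%E.
Proof.
case/andP: (alpha01) => a0 a1.
have diamK (x y : K) : mdist x y <= 1.
  by rewrite -lee_fin -Kdiam; apply: ereal_sup_ubound; exists x => //; exists y.
have [C [r [C0 /andP[r0 r1] decay]]] := oscillation_decay hm.
(* [b] exceeds both rates; [D] is such that [D b^n] dominates the recursion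
   [a_(n+1) = alpha a_n + 2 C r^n] *)
pose b := (1 + Num.max alpha r) / 2.
have [ab rb b1] : [/\ alpha < b, r <= b & b < 1].
  have ma : alpha <= Num.max alpha r by rewrite le_max lexx.
  have mr : r <= Num.max alpha r by rewrite le_max lexx orbT.
  have m1 : Num.max alpha r < 1 by rewrite gt_max a1.
  by rewrite /b; split; lra.
have b0 : 0 < b by exact: lt_trans ab.
pose D := 1 + 2 * C / (b - alpha).
have ba0 : 0 < b - alpha by rewrite subr_gt0.
have D1 : 1 <= D by rewrite lerDl divr_ge0 ?(ltW ba0)// mulr_ge0.
have DE : D * alpha + 2 * C <= D * b.
  have : 2 * C / (b - alpha) * (b - alpha) = 2 * C by rewrite divfK// gt_eqF.
  by rewrite /D; lra.
exists D, b; split; first by rewrite b0.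
move=> mu muV n _; have mu0 := Vspace_mass0 muV; have [[[mAB Lfin] mLip] _] := muV.
have dens := Sinf_has_density muV.1.
have Lge0 := Linf_norm_ge0 m mu.
have c0 : 0 < D * b ^+ n by rewrite mulr_gt0 ?exprn_gt0// (lt_le_trans ltr01).
have l0 := lip_const_ge0 point (phi1 m mu).
have s0 : (0 <= sup_norm (phi1 m mu))%E.
  by apply: le_trans (sup_norm_ub _ point); rewrite lee_fin.
have [sinf|sfin] := eqVneq (sup_norm (phi1 m mu)) +oo%E.
  rewrite /Sinf_norm /lip_norm sinf addye ?addye ?gt0_muley ?leey//.
  - by rewrite gt_eqF// (lt_le_trans _ Lge0) ?ltNy0.
  - by rewrite gt_eqF// (lt_le_trans _ l0) ?ltNy0.
have /fineK sE : sup_norm (phi1 m mu) \is a fin_num by rewrite ge0_fin_numE// ltey.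
have /fineK lE : lip_const (phi1 m mu) \is a fin_num by rewrite ge0_fin_numE.
have /fineK LE : Linf_norm m mu \is a fin_num by rewrite ge0_fin_numE.
rewrite /Sinf_norm /lip_norm -sE -lE -LE -!EFinD -EFinM.
set s := fine (sup_norm _); set v := fine (lip_const _); set L := fine (Linf_norm _ _).
have s0' : 0 <= s by exact: fine_ge0.
have v0 : 0 <= v by exact: fine_ge0.
have L0 : 0 <= L by exact: fine_ge0.
pose phi j := iter j (transfer P p) (phi1 m mu).
have densj j : has_density m (iter j (F_star G) mu) (phi j).
  by elim: j => [//|j ih]; rewrite /phi !iterS; exact: has_density_F_star.
have massj j : iter j (F_star G) mu setT = 0%E.
  by elim: j => [//|j ih]; rewrite iterS F_starE preimage_setT.
have phis j x : `|phi j x| <= C * r ^+ j * (v + 2 * s).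
  have var : letterwise_lipschitz v (phi1 m mu) by move=> ? ? _; exact: lip_constP.
  have osc : oscillation_le (2 * s) (phi1 m mu).
    exists (- s) => y; have : `|phi1 m mu y| <= s by rewrite -lee_fin sE; exact: sup_norm_ub.
    by rewrite ler_norml => /andP[? ?]; apply/andP; split; lra.
  have [a fa] := decay _ _ _ j v0 (mulr_ge0 (ler0n _ 2) s0') var osc.
  have /andP[? ?] := has_density_bounds (massj j) (densj j) fa.
  have := fa x; rewrite -/(phi j x) ler_norml => /andP[? ?].
  by apply/andP; split; lra.
elim: n c0 => [|n ih] _.
  rewrite /= -LE lee_fin expr0 mulr1 -/L; apply: (@le_trans _ _ (1 * (s + v + L))).
    by rewrite mul1r; lra.
  by rewrite ler_wpM2r//; lra.
rewrite iterS; apply: le_trans (Linf_norm_F_star hm Kcompact diamK alpha01 Gcontr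
  (densj n) (phis n) (ih _)) _; first by rewrite mulr_gt0 ?exprn_gt0// (lt_le_trans ltr01).
rewrite lee_fin exprS.
have bn0 : 0 <= b ^+ n by rewrite exprn_ge0// ltW.
have rbn : r ^+ n <= b ^+ n by apply: lerXn2r; rewrite ?nnegrE ?(ltW r0) ?(ltW b0).
set q := s + v + L.
have h1 : C * r ^+ n * (v + 2 * s) <= 2 * C * (b ^+ n * q).
  have -> : 2 * C * (b ^+ n * q) = C * b ^+ n * (2 * q) by ring.
  apply: ler_pM => //.
  - by rewrite mulr_ge0// exprn_ge0// ltW.
  - by rewrite addr_ge0// mulr_ge0.
  - by rewrite ler_wpM2l.
  - by rewrite /q; lra.
have h2 : (D * alpha + 2 * C) * (b ^+ n * q) <= D * b * (b ^+ n * q).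
  by rewrite ler_wpM2r// mulr_ge0// /q !addr_ge0.
have -> : D * (b * b ^+ n) * q = D * b * (b ^+ n * q) by ring.
have -> : alpha * (D * b ^+ n * q) = D * alpha * (b ^+ n * q) by ring.
by apply: le_trans h2; rewrite [leRHS]mulrDl lerD2l.
Qed.
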